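(* Let $G$ be a second countable étale essentially principal groupoid whose unit space $G^{(0)}$ is compact and totally disconnected, and suppose $G$ is almost finite. Then the index map $I:[[G]]\to H_1(G)$ is surjective.
   Context: An étale groupoid is a locally compact Hausdorff groupoid whose range map $r$ is a local homeomorphism; $s$ is the source map. $G$ is essentially principal if the interior of $\{g\in G: r(g)=s(g)\}$ equals $G^{(0)}$. A $G$-set is a subset $U$ with $r|_U,s|_U$ injective; $\tau_U=r\circ(s|_U)^{-1}$. $[[G]]$ is the group of homeomorphisms of $G^{(0)}$ of the form $\tau_U$ for a compact open $G$-set $U$; by essential principality such $U$ is unique. Homology: let $G^{(1)}=G$, $G^{(2)}=\{(g_1,g_2): s(g_1)=r(g_2)\}$; for a local homeomorphism $\pi:X\to Y$, $\pi_*:C_c(X,\mathbb{Z})\to C_c(Y,\mathbb{Z})$, $\pi_*(f)(y)=\sum_{\pi(x)=y}f(x)$. Put $\delta_1=s_*-r_*:C_c(G,\mathbb{Z})\to C(G^{(0)},\mathbb{Z})$ and $\delta_2=d_{0*}-d_{1*}+d_{2*}:C_c(G^{(2)},\mathbb{Z})\to C_c(G,\mathbb{Z})$ where $d_0(g_1,g_2)=g_2$, $d_1(g_1,g_2)=g_1g_2$, $d_2(g_1,g_2)=g_1$; $H_1(G)=\ker\delta_1/\operatorname{Im}\delta_2$. The index map is $I(\tau_U)=[1_U]\in H_1(G)$ (a homomorphism). Elementary subgroupoid: compact open principal subgroupoid $K$ with $K^{(0)}=G^{(0)}$. $G$ is almost finite if for every compact $C\subset G$ and $\varepsilon>0$ there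 is an elementary subgroupoid $K$ with $|CKx\setminus Kx|/|K(x)|<\varepsilon$ for all $x\in G^{(0)}$, where $Kx=\{k\in K: s(k)=x\}$, $CKx=\{ck:c\in C,k\in Kx,s(c)=r(k)\}$, $K(x)=r(Kx)$. *)

(* Defs.v *)
From HB Require Import structures.
From mathcomp Require Import all_boot all_order all_algebra.
From mathcomp Require Import all_classical all_reals topology.
From mathcomp Require Import Rstruct Rstruct_topology.
From mathcomp Require Import finmap.

Set Implicit Arguments.
Unset Strict Implicit.
Unset Printing Implicit Defensive.
Import Order.TTheory GRing.Theory Num.Theory.
Local Open Scope classical_set_scope.
Local Open Scope ring_scope.

(* A groupoid is given on a topological space G by a (total, but only
   meaningful on composable pairs) multiplication [mul], an inverse [inv],
   and range/source maps [r], [s] : G -> G whose common image is the unit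
   space G^(0) (viewed, as in the paper, as a subset of G). *)

Section Groupoid.
Variable G : topologicalType.
Variables (mul : G -> G -> G) (inv : G -> G) (r s : G -> G).

Definition unit_space : set G := range r.

Definition composable : set (G * G) := [set p | s p.1 = r p.2].

Definition is_groupoid : Prop :=
  [/\ (forall g, r (r g) = r g /\ s (r g) = r g /\ r (s g) = s g /\ s (s g) = s g),
      (forall g h, s g = r h -> r (mul g h) = r g /\ s (mul g h) = s h),
      (forall g h k, s g = r h -> s h = r k -> mul (mul g h) k = mul g (mul h k)),
      (forall g, mul (r g) g = g /\ mul g (s g) = g) &
      (forall g, [/\ r (inv g) = s g, s (inv g) = r g,
                     mul g (inv g) = r g & mul (inv g) g = s g])].

Definition local_homeo_onto {T U : topologicalType} (E : set U) (f : T -> U) :=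
  f @` setT `<=` E /\
  forall x : T, exists V : set T,
    [/\ open V, V x, {in V &, injective f}, {within V, continuous f} &
        forall O, open O -> O `<=` V ->
          exists W : set U, open W /\ f @` O = W `&` E].

Definition is_etale_groupoid : Prop :=
  is_groupoid /\
  [/\ hausdorff_space G,
      locally_compact [set: G],
      {within composable, continuous (fun p : G * G => mul p.1 p.2)},
      continuous inv &
      local_homeo_onto unit_space r].

Definition essentially_principal : Prop :=
  (interior [set g | r g = s g]) = unit_space.

Definition compact_open_Gset (U : set G) : Prop :=
  [/\ compact U, open U, {in U &, injective r} & {in U &, injective s}].

(* U is a compact open G-set such that tau_U = r o (s|_U)^-1 is a
   homeomorphism of G^(0), i.e. r(U) = s(U) = G^(0); these are exactly the
   bisections whose tau_U are the elements of [[G]]. *)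
Definition full_Gset (U : set G) : Prop :=
  compact_open_Gset U /\ r @` U = unit_space /\ s @` U = unit_space.

(* Integer-valued continuous (= locally constant, Z discrete) functions on a
   subspace D, and compact support. *)
Definition loc_const_on {T : topologicalType} (D : set T) (f : T -> int) :=
  forall p, D p -> exists N, nbhs p N /\ forall q, D q -> N q -> f q = f p.

Definition Cc_on {T : topologicalType} (D : set T) (f : T -> int) :=
  [/\ loc_const_on D f,
      (forall p, ~ D p -> f p = 0) &
      exists K, [/\ compact K, K `<=` D & forall p, ~ K p -> f p = 0]].

Definition push {T U : choiceType} (D : set T) (pi : T -> U) (f : T -> int) (y : U)
  : int := \sum_(x \in D `&` pi @^-1` [set y]) f x.

Definition delta1 (f : G -> int) : G -> int :=
  fun x => push setT s f x - push setT r f x.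

Definition delta2 (h : G * G -> int) : G -> int :=
  fun g => push composable (fun p => p.2) h g
           - push composable (fun p => mul p.1 p.2) h g
           + push composable (fun p => p.1) h g.

Definition indic (U : set G) (g : G) : int := if `[< U g >] then 1 else 0.

(* Index map I : [[G]] -> H_1(G), tau_U |-> [1_U], is surjective:
   every class [f] (f in C_c(G,Z), delta1 f = 0) equals [1_U] for some
   U in [[G]], i.e. 1_U - f lies in Im delta2. *)
Definition index_map_surjective : Prop :=
  forall f : G -> int, Cc_on setT f ->
    (forall x, unit_space x -> delta1 f x = 0) ->
    exists U, full_Gset U /\
      exists h : G * G -> int, Cc_on composable h /\
        forall g, indic U g - f g = delta2 h g.

Definition elementary (K : set G) : Prop :=
  compact K /\ open K /\
  [/\ (forall g h, K g -> K h -> s g = r h -> K (mul g h)),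
      (forall g, K g -> K (inv g)),
      r @` K = unit_space &
      (forall k, K k -> r k = s k -> unit_space k)].

Definition Kx (K : set G) (x : G) : set G := [set k | K k /\ s k = x].
Definition CKx (C K : set G) (x : G) : set G :=
  [set g | exists c k, [/\ C c, Kx K x k, s c = r k & g = mul c k]].
Definition Korb (K : set G) (x : G) : set G := r @` Kx K x.

Definition almost_finite : Prop :=
  forall (C : set G) (eps : Rdefinitions.R), compact C -> 0 < eps ->
    exists K, elementary K /\
      forall x, unit_space x ->
        (#|` fset_set (CKx C K x `\` Kx K x)|%:R / #|` fset_set (Korb K x)|%:R
           < eps)%R.

End Groupoid.

(* Main.v *)
(** Let [K] be an elementary subgroupoid. Ordering its finite orbits by a locally
    constant label gives each unit [x] a height, its position in its orbit, and
    an element [t x] of [K] from [x] to the lowest point of that orbit. The map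
    [pi g = t (r g) g (t (s g))^-1] is etale, and every 1-cycle is homologous to
    its pushforward along [pi], because the two error terms are the images under
    [t] of [s_* phi] and [r_* phi], which agree. Functions supported on units are
    boundaries, so only the values of the pushforward off the units matter.

    A cycle [f] is homologous to the nonnegative cycle [F = f^+ + f^- o inv].
    Almost finiteness provides [K] such that, for every lowest point [y], the
    total weight [m y] of [pi_* F] at non-units with source [y] (equivalently,
    with range [y]) is at most the size of the orbit of [y]. Hence these arrows,
    counted with multiplicity, can be listed once by source and once by range,
    and lifted to arrows that join distinct points of height less than [m]; the
    lifts and the units of height at least [m] form a full bisection [U] with
    [pi_* 1_U = pi_* F] off the units. *)

From HB Require Import structures.
From mathcomp Require Import all_boot all_order all_algebra.
From mathcomp Require Import finmap.
From mathcomp Require Import all_classical all_reals topology Rstruct zify.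
Require Import Defs.

Set Implicit Arguments.
Unset Strict Implicit.
Unset Printing Implicit Defensive.
Import Order.TTheory GRing.Theory Num.Theory.
Local Open Scope classical_set_scope.
Local Open Scope ring_scope.

(** * Étale maps, locally constant functions and clopen bases *)

Definition etale {T U : topologicalType} (f : T -> U) : Prop :=
  [/\ continuous f, (forall O, open O -> open (f @` O)) &
      forall x, exists V, [/\ open V, V x & {in V &, injective f}]].

Definition loc_const {T : topologicalType} {V : Type} (f : T -> V) : Prop :=
  forall x, \forall y \near x, f y = f x.

Definition clopen_basis (T : topologicalType) : Prop :=
  forall (x : T) O, open O -> O x -> exists B, [/\ clopen B, B x & B `<=` O].

(** * Topological preliminaries *)

(** If every clopen neighbourhood of [x] inside [A] met [K], the traces on [K] would generate a
    proper filter; at a cluster point [y], a clopen set containing [x] but not [y] gives a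
    contradiction. *)
Lemma clopen_avoid_compact (T : topologicalType) (x : T) (A K : set T) :
  clopen A -> A x -> compact K ->
  (forall y, K y -> exists D, [/\ clopen D, D x & ~ D y]) ->
  exists D, [/\ clopen D, D x, D `<=` A & D `&` K = set0].
Proof.
move=> cA Ax cK sep; apply: contrapT => noD.
pose F := filter_from [set D : set T | clopen D /\ D x] (fun D => D `&` K).
have FF : Filter F.
  apply: filter_from_filter; first by exists setT; split => //; exact: clopenT.
  move=> B C [cB Bx] [cC Cx]; exists (B `&` C); first by split=> //; exact: clopenI.
  by move=> z [[]].
have PF : ProperFilter F.
  apply: filter_from_proper => // D [cD Dx]; apply: contrapT => /nonemptyPn DK0.
  apply: noD; exists (D `&` A); split=> //; first exact: clopenI.
  by apply/seteqP; split=> z // [[Dz _] Kz]; rewrite -DK0.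
have FK : F K by exists setT; [split=> //; exact: clopenT | move=> z []].
have [y [Ky]] := cK F PF FK.
have [D [[oD cD] Dx Dy]] := sep y Ky.
move=> /(_ (D `&` K) (~` D)) [].
- by exists D.
- by apply: open_nbhs_nbhs; split=> //; exact: closed_openC.
- by move=> z [[? _]].
Qed.

(* In a compact Hausdorff space the quasi-component of a point is connected. *)
Lemma totally_disconnected_clopen (T : topologicalType) (A : set T) :
  hausdorff_space T -> compact A -> open A -> totally_disconnected A ->
  forall x O, A x -> open O -> O x -> exists B, [/\ clopen B, B x & B `<=` A `&` O].
Proof.
move=> hT cA oA tdA x O Ax oO Ox.
have clA : closed A by exact: compact_closed.
have cloA : clopen A by [].
pose Q := \bigcap_(B in [set B | clopen B /\ B x]) B.
have Qx : Q x by move=> B [].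
have QA : Q `<=` A by move=> z; apply.
have clQ : closed Q by apply: closed_bigI => B [[]].
(* The compact set to avoid is the part of [A] outside [P]: its points lie outside the
   quasi-component [Q], so each is cut off from [x] by a clopen set. *)
have sepQ (P : set T) : open P -> Q `<=` P ->
    exists B, [/\ clopen B, B x & B `<=` A `&` P].
  move=> oP QP.
  have [||D [cD Dx DA DK]] := @clopen_avoid_compact T x A (A `\` P) cloA Ax.
  - by apply: (subclosed_compact _ cA) => [|z []//]; apply: closedI => //;
      exact: open_closedC.
  - move=> y [Ay Py]; apply: contrapT => noD; apply: Py; apply: QP => B [cB Bx].
    by apply: contrapT => By; apply: noD; exists B.
  exists D; split=> // z Dz; split; first exact: DA.
  by apply: contrapT => Pz; have : set0 z by rewrite -DK; split=> //; split=> //; exact: DA.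
apply: (sepQ O oO) => z Qz.
suff cQ : connected Q.
  have : connected_component A x z by exists Q.
  by rewrite (tdA x Ax) => ->.
move=> {z Qz} B B0 [C oC BC] [C' cC' BC'].
(* The rest of [Q] is relatively clopen too, so the two pieces may be exchanged to put [x] in
   [B]. *)
wlog Bx : B C C' B0 oC BC cC' BC' / B x.
  move=> wl; have [Bx|Bx] := pselect (B x); first exact: (wl B C C').
  have [[z Qz]|Q'0] := pselect ((Q `\` B) !=set0).
    have eq : Q `\` B = Q.
      apply: (wl (Q `\` B) (~` C') (~` C)); [by exists z| | | | |by split].
      - exact: closed_openC.
      - rewrite BC'; apply/seteqP; split=> w [Qw Hw]; split=> //; first by move=> ?; apply: Hw.
        by case.
      - exact: open_closedC.
      - rewrite BC; apply/seteqP; split=> w [Qw Hw]; split=> //; first by move=> ?; apply: Hw.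
        by case.
    case: B0 => b Bb; have : Q b by move: Bb; rewrite BC => -[].
    by rewrite -{1}eq => -[].
  by exfalso; apply: Q'0; exists x.
have clB : closed B by rewrite BC'; exact: closedI.
have clQB : closed (Q `\` B).
  suff -> : Q `\` B = Q `&` ~` C by apply: closedI => //; exact: open_closedC.
  rewrite BC; apply/seteqP; split=> w [Qw Hw]; split=> //; first by move=> ?; apply: Hw.
  by case.
have BA : B `<=` A by move=> w Bw; apply: QA; move: Bw; rewrite BC => -[].
have nB : {for B, @normal_space T}.
  by apply: (compact_normal_local hT cA) => w /BA Aw; exact: open_nbhs_nbhs.
have [|N BN NC] := nB clB (~` (Q `\` B)).
  by apply/set_nbhsP; exists (~` (Q `\` B)); split=> //;
    [exact: closed_openC | move=> w Bw []].
have /set_nbhsP[P [oP BP PN]] := BN.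
(* This [D] meets [P] and [closure N] in the same set, which is therefore clopen; it contains [x],
   hence all of [Q]. *)
have [||D [[oD cD] Dx DAP]] := sepQ (P `|` ~` closure N).
- by apply: openU => //; apply: closed_openC; exact: closed_closure.
- move=> w Qw; have [Bw|Bw] := pselect (B w); [by left; exact: BP | right].
  by move=> /NC; apply.
have cDP : clopen (D `&` P).
  split; first exact: openI.
  suff -> : D `&` P = D `&` closure N by apply: closedI => //; exact: closed_closure.
  apply/seteqP; split=> w [Dw Hw]; split=> //; first exact/subset_closure/PN.
  by have [_ []//] := DAP w Dw.
apply/seteqP; split=> w; first by rewrite BC => -[].
move=> Qw; have [_ Pw] : (D `&` P) w by apply: Qw; split=> //; split=> //; exact: BP.
apply: contrapT => Bw; have := NC w; apply=> //.
exact/subset_closure/PN.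
Qed.

(** The image filter clusters at some [f x] with [x] in [V]; openness of [f] and injectivity on [V]
    carry the clustering back to [x]. *)
Lemma etale_compact_preimage (T U : topologicalType) (f : T -> U) (V : set T) :
  etale f -> open V -> {in V &, injective f} -> compact (f @` V) -> compact V.
Proof.
move=> [_ opf _] oV injV cfV F PF FV.
have [|_ [[x Vx <-]] clx] := cfV (f @ F) _.
  by rewrite /nbhs/=; apply: filterS FV => z Vz; exists z.
exists x; split=> // A B FA /nbhs_interior Bx.
have [||_ [[a [Aa Va] <-] [b [Bb Vb] fab]]] := clx (f @` (A `&` V)) (f @` (B^° `&` V)).
- by rewrite /nbhs/=; apply: filterS (filterI FA FV) => z ?; exists z.
- apply: open_nbhs_nbhs; split; last by exists x => //; split=> //; exact: nbhs_singleton.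
  by apply: opf; apply: openI => //; exact: open_interior.
exists a; split=> //.
have ba : b = a := injV b a (mem_set Vb) (mem_set Va) fab.
by rewrite -ba; exact: interior_subset Bb.
Qed.

Lemma etale_comp (T U W : topologicalType) (f : T -> U) (g : U -> W) :
  etale f -> etale g -> etale (g \o f).
Proof.
move=> [cf opf lif] [cg opg lig]; split=> [x|O oO|x].
- by apply: continuous_comp; [exact: cf | exact: cg].
- by rewrite -image_comp; apply: opg; exact: opf.
- have [V [oV Vx injV]] := lif x; have [W' [oW' Wx injW]] := lig (f x).
  exists (V `&` f @^-1` W'); split=> //.
    by apply: openI => //; apply: open_comp => // z _; exact: cf.
  move=> a b; rewrite !inE => -[Va Wa] [Vb Wb] /= gab.
  by apply: injV; rewrite ?inE//; apply: injW; rewrite ?inE.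
Qed.

(** Where [q] is injective, the image of a small open set under [f] is recovered from its open image
    under [q \o f]. This makes [rho], [rho'] and [t \o r] étale, since following them by [s] or [r]
    gives [s] or [r]. *)
Lemma etale_factor (T U W : topologicalType) (f : T -> U) (q : U -> W) :
  continuous f -> etale q -> etale (q \o f) -> etale f.
Proof.
move=> cf [cq oq iq] [_ oqf iqf]; split=> // [O oO|x]; last first.
  have [V [oV Vx injV]] := iqf x; exists V; split=> // a b Va Vb fab.
  by apply: injV => //=; rewrite fab.
rewrite openE => _ [x Ox <-].
have [V [oV Vx injV]] := iq (f x).
pose O' := O `&` f @^-1` V.
have oO' : open O' by apply: openI => //; apply: open_comp => // z _; exact: cf.
have : nbhs (f x) (V `&` q @^-1` ((q \o f) @` O')).
  apply: open_nbhs_nbhs; split; first by apply: openI => //;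
    apply: open_comp => [z _|]; [exact: cq | exact: oqf].
  by split=> //; exists x.
apply: filterS => y [Vy [z [Oz Vz] /= qz]]; exists z => //.
by apply: injV; rewrite ?inE.
Qed.

(** Otherwise the sets of points of [S] missed by finite lists would generate a proper filter; a
    cluster point [x] contradicts the list made of [x] alone. *)
Lemma compact_finite_cover (T : topologicalType) (S : set T) (A : T -> set T) :
  compact S -> (forall x, S x -> nbhs x (A x)) ->
  exists2 l : seq T, (forall x, x \in l -> S x) &
    forall y, S y -> exists2 x, x \in l & A x y.
Proof.
move=> cS HA; apply: contrapT => nol.
pose F := filter_from [set l : seq T | forall x, x \in l -> S x]
  (fun l => [set y | S y /\ forall x, x \in l -> ~ A x y]).
have FF : Filter F.
  apply: filter_from_filter; first by exists [::].
  move=> l m lS mS; exists (l ++ m) => [x|y [Sy Hy]].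
    by rewrite mem_cat => /orP[/lS|/mS].
  by split; split=> // x xl; apply: Hy; rewrite mem_cat xl ?orbT.
have PF : ProperFilter F.
  apply: filter_from_proper => // l lS; apply: contrapT => /nonemptyPn l0.
  apply: nol; exists l => // y Sy; apply: contrapT => nox.
  have : set0 y by rewrite -l0; split=> // x xl Axy; apply: nox; exists x.
  by [].
have FS : F S by exists [::] => // y [].
have [x [Sx clx]] := cS F PF FS.
have [||y [[_ Hy] Axy]] := clx [set y | S y /\ forall z, z \in [:: x] -> ~ A z y] (A x).
- by exists [:: x] => // z; rewrite inE => /eqP ->.
- exact: HA.
- by apply: (Hy x); rewrite ?inE.
Qed.

(** The label is the index of the first member of a finite clopen cover that contains the point. *)
Lemma compact_label (T : topologicalType) (S : set T) (P : set T -> Prop) :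
  compact S ->
  (forall x, S x -> exists A, [/\ clopen A, A x & P A]) ->
  exists (n : nat) (la : T -> nat), [/\ loc_const la, (forall x, S x -> (la x < n)%N) &
    forall x y, S x -> S y -> la x = la y -> exists A, [/\ P A, A x & A y]].
Proof.
move=> cS HS.
have /choice[A HA] : forall x, exists A, S x -> [/\ clopen A, A x & P A].
  by move=> x; have [/HS[A ?]|Sx] := pselect (S x); [exists A | exists setT].
have [|l lS Scov] := @compact_finite_cover T S A cS.
  by move=> x /HA[[oA _] Ax _]; exact: open_nbhs_nbhs.
have cl : forall x, x \in l -> clopen (A x) by move=> x /lS /HA[].
pose la g := find (fun x => `[< A x g >]) l.
exists (size l), la.
have lt g : S g -> (la g < size l)%N.
  move=> Sg; rewrite -has_find; apply/hasP.
  by have [x xD Axg] := Scov g Sg; exists x => //; apply/asboolP.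
split=> // [|x y Sx Sy eql].
  rewrite /la; move: cl; clear; elim: l => [|a l IH] cl g /=; first exact: nearW.
  have {IH}IH := IH _ g; have [oA cA] : clopen (A a) by apply: cl; rewrite mem_head.
  case: asboolP => Ag.
    have : nbhs g (A a) by exact: open_nbhs_nbhs.
    by apply: filterS => h Ah; case: asboolP.
  have nA : nbhs g (~` A a) by apply: open_nbhs_nbhs; split=> //; exact: closed_openC.
  have {}IH := IH (fun x xl => cl x (mem_behead (s := a :: l) xl)).
  by apply: filterS2 nA IH => h Ah eq; case: asboolP => // _; rewrite eq.
have hx : has (fun z => `[< A z x >]) l by rewrite has_find lt.
have hy : has (fun z => `[< A z y >]) l by rewrite has_find lt.
exists (A (nth x l (la x))); split.
- by case: (HA (nth x l (la x))) => //; exact/lS/mem_nth/lt.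
- exact/asboolP/(nth_find x hx).
- by rewrite eql; exact/asboolP/(nth_find x hy).
Qed.

(** * Pushforward of integer-valued functions *)

(** A sum with infinite support takes the default value 0; this finiteness is what makes [push]
    additive and functorial. *)
Definition fiber_finite {T U : choiceType} (D : set T) (pi : T -> U)
    (f : T -> int) : Prop :=
  forall y, finite_set [set x | [/\ D x, pi x = y & f x != 0]].

Section Push.
Variables (T U : choiceType) (D : set T) (pi : T -> U).
Implicit Types f g : T -> int.

(** Frees the sum from its exact support, so that several functions can be summed over one common
    list. *)
Lemma push_seq f y (l : seq T) : uniq l ->
  (forall x, D x -> pi x = y -> f x != 0 -> x \in l) ->
  (forall x, x \in l -> D x) ->
  push D pi f y = \sum_(x <- l | pi x == y) f x.
Proof.
move=> ul suppl lD; rewrite /push.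
rewrite (fsbigE [seq x <- l | pi x == y]) ?filter_uniq//.
- rewrite big_filter_cond big_seq_cond [RHS]big_seq_cond; apply: eq_bigl => x.
  case: (boolP (x \in l)) => //= xl; case: eqP => //= pxy.
  by rewrite mem_set//; split=> //; exact: lD.
- by move=> x /=; rewrite mem_filter => /andP[/eqP ? /lD].
- move=> x [Dx px]; rewrite mem_filter negb_and => nxl; apply/eqP.
  apply: contraT => fx0; move: nxl.
  by rewrite (suppl x Dx px fx0) px eqxx.
Qed.

Lemma push_ffin f y : fiber_finite D pi f ->
  exists l : seq T, [/\ uniq l, (forall x, x \in l -> D x) &
    forall x, D x -> pi x = y -> f x != 0 -> x \in l].
Proof.
move=> ff; exists (fset_set [set x | [/\ D x, pi x = y & f x != 0]]); split.
- exact: fset_uniq.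
- by move=> x; rewrite in_fset_set// inE => -[].
- by move=> x Dx px fx; rewrite in_fset_set// inE.
Qed.

Lemma push_ffin2 f g y : fiber_finite D pi f -> fiber_finite D pi g ->
  exists l : seq T, [/\ uniq l, (forall x, x \in l -> D x),
    (forall x, D x -> pi x = y -> f x != 0 -> x \in l) &
    (forall x, D x -> pi x = y -> g x != 0 -> x \in l)].
Proof.
move=> /(push_ffin y)[l [_ lD lf]] /(push_ffin y)[m [_ mD mg]].
exists (undup (l ++ m)); split; first exact: undup_uniq.
- by move=> x; rewrite mem_undup mem_cat => /orP[/lD|/mD].
- by move=> x Dx px fx; rewrite mem_undup mem_cat lf.
- by move=> x Dx px fx; rewrite mem_undup mem_cat mg ?orbT.
Qed.

Lemma pushD f g y : fiber_finite D pi f -> fiber_finite D pi g ->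
  push D pi (fun x => f x + g x) y = push D pi f y + push D pi g y.
Proof.
move=> ff fg; have [l [ul lD lf lg]] := push_ffin2 y ff fg.
rewrite !(push_seq ul)// ?big_split// => x Dx px.
have [fx0|/(lf _ Dx px)//] := eqVneq (f x) 0.
by rewrite fx0 add0r; exact: lg.
Qed.

Lemma pushN f y : push D pi (fun x => - f x) y = - push D pi f y.
Proof.
rewrite /push -mulN1r mulr_fsumr; apply: eq_fsbigr => x _.
by rewrite mulN1r.
Qed.

Lemma push_eq0 f y : (forall x, D x -> pi x = y -> f x = 0) -> push D pi f y = 0.
Proof. by move=> f0; apply: fsbig1 => x [Dx px]; exact: f0. Qed.

Lemma push_eq1 f x : D x ->
  (forall x', D x' -> pi x' = pi x -> f x' != 0 -> x' = x) ->
  push D pi f (pi x) = f x.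
Proof.
move=> Dx ux; rewrite (@push_seq _ _ [:: x])//.
- by rewrite big_cons big_nil eqxx addr0.
- by move=> z Dz pz fz; rewrite inE (ux z).
- by move=> z; rewrite inE => /eqP ->.
Qed.

Lemma push_ge0 f y : (forall x, 0 <= f x) -> 0 <= push D pi f y.
Proof. by move=> f0; apply: fsumr_ge0 => x _. Qed.

Lemma le_push f g y : fiber_finite D pi f -> fiber_finite D pi g ->
  (forall x, f x <= g x) -> push D pi f y <= push D pi g y.
Proof.
move=> ff fg fleg; have [l [ul lD lf lg]] := push_ffin2 y ff fg.
by rewrite !(push_seq ul)//; apply: ler_sum.
Qed.

Lemma term_le_push f x : fiber_finite D pi f -> (forall x, 0 <= f x) -> D x ->
  f x <= push D pi f (pi x).
Proof.
move=> ff f0 Dx; have [l [ul lD ls]] := push_ffin (pi x) ff.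
rewrite (push_seq ul)//; have [->|fx] := eqVneq (f x) 0; first exact: sumr_ge0.
by rewrite (big_rem x)/= ?eqxx ?lerDl ?sumr_ge0//; exact: ls.
Qed.

Lemma push_neq0 f y : push D pi f y != 0 -> exists x, [/\ D x, pi x = y & f x != 0].
Proof.
apply: contraPP => nox; rewrite push_eq0 ?eqxx// => x Dx px.
by apply/eqP; apply: contraT => fx; exfalso; apply: nox; exists x.
Qed.

End Push.

(** When [g y = z], the fibre of [f] over [y] lies in that of [g \o f] over [z]; one list thus
    serves all such [y], and the two sums are exchanged. *)
Lemma push_comp (T U V : choiceType) (f : T -> U) (g : U -> V) (phi : T -> int) :
  fiber_finite setT (g \o f) phi ->
  forall z, push setT g (push setT f phi) z = push setT (g \o f) phi z.
Proof.
move=> ff z; have [l [ul _ ls]] := push_ffin z ff.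
rewrite (push_seq ul)//.
pose m := undup (map f l).
have pfE y : g y = z -> push setT f phi y = \sum_(x <- l | f x == y) phi x.
  by move=> gy; apply: push_seq => // x _ fx px; apply: ls => //=; rewrite fx.
rewrite (@push_seq _ _ _ _ _ _ m) ?undup_uniq//; last first.
  move=> y _ gy; rewrite (pfE _ gy) => nz.
  have : has (fun x => f x == y) l.
    apply: contraNT nz => /hasPn nof; rewrite big_seq_cond big_pred0// => x.
    by apply/andP => -[/nof/negP].
  by move=> /hasP[x xl /eqP <-]; rewrite mem_undup map_f.
under eq_bigr => y /eqP gy do rewrite (pfE _ gy).
rewrite (exchange_big_dep (fun x => g (f x) == z))/=; last first.
  by move=> y x gy /eqP ->.
rewrite big_seq_cond [RHS]big_seq_cond.
apply: eq_bigr => x /andP[xl /eqP gx].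
rewrite big_mkcond (bigD1_seq (f x)) ?undup_uniq ?mem_undup ?map_f//=.
rewrite gx !eqxx /= big1_seq ?addr0// => y /andP[nyx _].
by rewrite (eq_sym (f x)) (negbTE nyx) andbF.
Qed.

(** * Locally constant functions *)

Section LocConst.
Variable T : topologicalType.

Lemma loc_const_fun (V W : Type) (f : T -> V) (h : V -> W) :
  loc_const f -> loc_const (fun x => h (f x)).
Proof. by move=> lf x; apply: filterS (lf x) => y ->. Qed.

Lemma loc_const_fun2 (V V' W : Type) (f : T -> V) (g : T -> V') (h : V -> V' -> W) :
  loc_const f -> loc_const g -> loc_const (fun x => h (f x) (g x)).
Proof. by move=> lf lg x; apply: filterS2 (lf x) (lg x) => y -> ->. Qed.

Lemma loc_const_cst (V : Type) (c : V) : loc_const (fun _ : T => c).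
Proof. by move=> x; exact: nearW. Qed.

Lemma loc_const_comp (U : topologicalType) (V : Type) (f : U -> T) (g : T -> V) :
  continuous f -> loc_const g -> loc_const (g \o f).
Proof. by move=> cf lg x; exact: (cf x _ (lg (f x))). Qed.

Lemma loc_const_open (V : Type) (f : T -> V) (P : V -> Prop) :
  loc_const f -> open [set x | P (f x)].
Proof. by move=> lf; rewrite openE => x Px; apply: filterS (lf x) => y /= ->. Qed.

Lemma loc_const_clopen (V : Type) (f : T -> V) (P : V -> Prop) :
  loc_const f -> clopen [set x | P (f x)].
Proof.
move=> lf; split; first exact: loc_const_open.
have := @loc_const_open V f (fun v => ~ P v) lf => /open_closedC.
by congr closed; apply/seteqP; split=> x /= ; [exact: contrapT | move=> ? ?].
Qed.

Lemma clopen_loc_const (A : set T) : clopen A -> loc_const (fun x => `[< A x >]).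
Proof.
move=> [oA cA] x; case: asboolP => Ax.
  have : nbhs x A by exact: open_nbhs_nbhs.
  by apply: filterS => y Ay; apply/asboolP.
have : nbhs x (~` A) by apply: open_nbhs_nbhs; split=> //; exact: closed_openC.
by apply: filterS => y Ay; apply/asboolPn.
Qed.

End LocConst.

(** * Compactly supported locally constant functions *)

Section Cc.
Variable T : topologicalType.
Hypothesis hT : hausdorff_space T.
Implicit Types f g : T -> int.

Lemma CcP f : Cc_on setT f <->
  loc_const f /\ exists2 K, compact K & forall x, ~ K x -> f x = 0.
Proof.
split=> [[lf _ [K [cK _ K0]]]|[lf [K cK K0]]].
  split; last by exists K.
  by move=> x; have [//|N [nN HN]] := lf x; apply: filterS nN => y Ny; exact: HN.
split=> [x _|x /(_ I)//|]; last by exists K; split.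
by exists [set y | f y = f x]; split=> //; exact: lf.
Qed.

Lemma Cc_loc_const f : Cc_on setT f -> loc_const f.
Proof. by move=> /CcP[]. Qed.

Lemma Cc_compact f : Cc_on setT f -> compact [set x | f x != 0].
Proof.
move=> /CcP[lf [K cK K0]]; apply: (subclosed_compact _ cK).
  by have [] := @loc_const_clopen T _ f (fun v => v != 0) lf.
by move=> x /= fx; apply: contrapT => /K0 f0; rewrite f0 eqxx in fx.
Qed.

Lemma Cc_supp f g : loc_const g -> Cc_on setT f ->
  (forall x, f x = 0 -> g x = 0) -> Cc_on setT g.
Proof.
move=> lg /CcP[lf [K cK K0]] fg; apply/CcP; split=> //.
by exists K => // x /K0 /fg.
Qed.

Lemma CcD f g : Cc_on setT f -> Cc_on setT g -> Cc_on setT (fun x => f x + g x).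
Proof.
move=> /CcP[lf [K cK K0]] /CcP[lg [L cL L0]]; apply/CcP; split.
  exact: (@loc_const_fun2 T _ _ _ f g (fun a b => a + b)).
exists (K `|` L); first exact: compactU.
by move=> x /not_orP[/K0 -> /L0 ->]; rewrite addr0.
Qed.

Lemma CcN f : Cc_on setT f -> Cc_on setT (fun x => - f x).
Proof.
move=> Cf; apply: (Cc_supp _ Cf); last by move=> x ->; rewrite oppr0.
exact: loc_const_fun (Cc_loc_const Cf).
Qed.

Lemma Cc_indic (A : set T) : compact A -> open A ->
  Cc_on setT (fun x => if `[< A x >] then 1 else 0 : int).
Proof.
move=> cA oA; apply/CcP; split; last by exists A => // x Ax; case: asboolP.
have := clopen_loc_const (conj oA (compact_closed hT cA)).
exact: (@loc_const_fun T _ _ _ (fun b : bool => if b then 1 else 0 : int)).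
Qed.

(** Finitely many sets of constancy cover the support; the absolute values at their centres add up
    to a bound. *)
Lemma Cc_bounded f : Cc_on setT f -> exists n : nat, forall x, f x <= n%:Z.
Proof.
move=> Cf; have lf := Cc_loc_const Cf.
have [l _ cov] := compact_finite_cover (Cc_compact Cf) (fun x _ => lf x).
exists (\sum_(x <- l) `|f x|)%N => y.
have [fy0|fy0] := eqVneq (f y) 0; first by rewrite fy0; lia.
have [x xl fyx] := cov y fy0.
suff : (`|f x| <= \sum_(x <- l) `|f x|)%N by rewrite fyx; lia.
by rewrite (big_rem x)//= leq_addr.
Qed.

End Cc.

(** * Pushforward along étale maps *)

Section EtalePush.
Variable T : topologicalType.
Hypotheses (hT : hausdorff_space T) (bT : clopen_basis T).

(** Finitely many sets on which [f] is injective cover [S], and each meets the fibre at most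
    once. *)
Lemma etale_finite (U : topologicalType) (f : T -> U) (S : set T) (y : U) :
  etale f -> compact S -> finite_set (S `&` f @^-1` [set y]).
Proof.
move=> [_ _ lif] cS.
have /choice[V HV] := lif.
have [|l _ cov] := @compact_finite_cover T S V cS.
  by move=> x _; have [oV Vx _] := HV x; exact: open_nbhs_nbhs.
have : finite_set (\bigcup_(x in [set` l]) (V x `&` f @^-1` [set y])).
  apply: bigcup_finite => // x _.
  have [[z Hz]|] := pselect (V x `&` f @^-1` [set y] !=set0); last first.
    by move=> /nonemptyPn ->.
  apply: (@sub_finite_set _ _ [set z]) => // z' [Vz' fz'] /=.
  have [_ _ inj] := HV x; case: Hz => Vz fz.
  by apply: inj; rewrite ?inE// fz' fz.
apply: sub_finite_set => z [Sz fz]; have [x xl Vxz] := cov z Sz.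
by exists x.
Qed.

Lemma Cc_fiber_finite (U : topologicalType) (f : T -> U) phi :
  etale f -> Cc_on setT phi -> fiber_finite setT f phi.
Proof.
move=> ef Cphi y.
apply: sub_finite_set (@etale_finite _ f _ y ef (Cc_compact Cphi)).
by move=> x [_ fx px].
Qed.

(** A label cuts [phi] into finitely many pieces whose supports map injectively. Pushing such a
    piece merely transports its values, and openness of [f] keeps them locally constant on the
    image. *)
Lemma Cc_push (f : T -> T) phi :
  etale f -> Cc_on setT phi -> Cc_on setT (push setT f phi).
Proof.
move=> ef Cphi; have [cf opf lif] := ef.
pose S := [set x | phi x != 0].
have cS : compact S by exact: Cc_compact.
apply/CcP; split; last first.
  exists (f @` S); first exact: continuous_compact (continuous_subspaceT cf) cS.
  move=> y nfS; apply: push_eq0 => x _ fx; apply/eqP; apply: contraT => px.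
  by exfalso; apply: nfS; exists x.
have [|n [la [lla ltla inj]]] := @compact_label T S (fun A => {in A &, injective f}) cS.
  move=> x _; have [V [oV Vx injV]] := lif x.
  have [B [cB Bx BV]] := bT oV Vx; exists B; split=> //.
  by move=> a b; rewrite !inE => Ba Bb; apply: injV; rewrite inE; exact: BV.
pose phi_ (P : pred nat) x := if P (la x) then phi x else 0.
have Cphi_ P : Cc_on setT (phi_ P).
  apply: (Cc_supp _ Cphi); last by move=> x px; rewrite /phi_ px if_same.
  exact: (@loc_const_fun2 T _ _ _ la phi (fun i v => if P i then v else 0) lla
           (Cc_loc_const Cphi)).
have -> : phi = phi_ (fun i => i < n)%N.
  apply/funext => x; rewrite /phi_; case: ifP => // /negbT lax; apply/eqP.
  by apply: contraNT lax => /ltla.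
elim: n {ltla} => [|n IH].
  suff -> : push setT f (phi_ (fun i => i < 0)%N) = fun=> 0 by exact: loc_const_cst.
  by apply/funext => y; apply: push_eq0.
have -> : push setT f (phi_ (fun i => i < n.+1)%N) =
    fun y => push setT f (phi_ (fun i => i < n)%N) y + push setT f (phi_ (pred1 n)) y.
  apply/funext => y; rewrite -pushD; [|exact: Cc_fiber_finite..].
  congr (push _ _ _ _); apply/funext => x; rewrite /phi_ /=; case: (ltngtP (la x) n) => h.
  - by rewrite ltnS (ltnW h) addr0.
  - by rewrite ltnS leqNgt h addr0.
  - by rewrite h ltnSn add0r.
apply: (@loc_const_fun2 T _ _ _ _ _ (fun a b => a + b) IH).
set p := phi_ (pred1 n).
have injp x x' : p x != 0 -> p x' != 0 -> f x = f x' -> x = x'.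
  rewrite /p /phi_ /=.
  case: (la x =P n) => // lx px; case: (la x' =P n) => // lx' px' fxx.
  have [|A [iA Ax Ax']] := inj x x' px px'; first by rewrite lx.
  by apply: iA => //; rewrite inE.
have pE x : p x != 0 -> push setT f p (f x) = p x.
  by move=> px; apply: push_eq1 => // x' _ fx' px'; exact: injp.
move=> y; have [[x [px fx]]|nox] := pselect (exists x, p x != 0 /\ f x = y).
  have : nbhs y (f @` [set x' | p x' = p x]).
    apply: open_nbhs_nbhs; split; last by exists x.
    by apply: opf; exact: (@loc_const_open T _ p (fun v => v = p x) (Cc_loc_const (Cphi_ _))).
  by apply: filterS => _ [x' px' <-]; rewrite -fx !pE ?px'.
(* Away from the image of the support, which is compact and hence closed, the pushforward vanishes
   on a whole neighbourhood. *)
have cfp : closed (f @` [set x | p x != 0]).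
  apply: (compact_closed hT); apply: continuous_compact; first exact: continuous_subspaceT.
  exact: Cc_compact (Cphi_ _).
have : nbhs y (~` (f @` [set x | p x != 0])).
  apply: open_nbhs_nbhs; split; first exact: closed_openC.
  by move=> [x px fx]; apply: nox; exists x.
have out z : (~` (f @` [set x | p x != 0])) z -> push setT f p z = 0.
  move=> nz; apply: push_eq0 => x _ fx; apply/eqP; apply: contraT => px.
  by exfalso; apply: nz; exists x.
apply: filterS => z nz; rewrite !out// => -[x px fx].
by apply: nox; exists x.
Qed.

End EtalePush.

(** * Ranking weighted points of a fibre *)

Section WeightedRank.
Variables (T U : choiceType) (f : T -> U) (phi : T -> int) (la : T -> nat).

(* If la separates the points of weight phi <> 0 in a fibre, the intervals
   [cum (la x) y, cum (la x) y + phi x) tile [0, push setT f phi y). *)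
Definition cum (n : nat) (y : U) : int :=
  push setT f (fun x => if (la x < n)%N then phi x else 0) y.

Hypotheses (ffin : fiber_finite setT f phi) (phi_ge0 : forall x, 0 <= phi x).

Let ffin_cond (P : pred nat) :
  fiber_finite setT f (fun x => if P (la x) then phi x else 0).
Proof.
move=> y; apply: sub_finite_set (ffin y) => x [_ fx].
by case: ifP => // _ px; split.
Qed.

Lemma cum_ge0 n y : 0 <= cum n y.
Proof. by apply: push_ge0 => x; case: ifP. Qed.

Lemma le_cum n m y : (n <= m)%N -> cum n y <= cum m y.
Proof.
move=> nm; apply: le_push => [||x];
  [exact: (ffin_cond (fun i => i < n)%N) | exact: (ffin_cond (fun i => i < m)%N) |].
by case: ifP => xn; case: ifP => xm //; lia.
Qed.

Lemma cum_le_push n y : cum n y <= push setT f phi y.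
Proof.
by apply: le_push => [||x];
  [exact: (ffin_cond (fun i => i < n)%N) | exact: ffin | case: ifP].
Qed.

Lemma cumS n y : cum n.+1 y =
  cum n y + push setT f (fun x => if la x == n then phi x else 0) y.
Proof.
rewrite /cum -pushD; [|exact: (ffin_cond (fun i => i < n)%N)|exact: (ffin_cond (pred1 n))].
congr (push _ _ _ _); apply/funext => x; case: (ltngtP (la x) n) => h.
- by rewrite ltnS (ltnW h) addr0.
- by rewrite ltnS leqNgt h addr0.
- by rewrite h ltnSn add0r.
Qed.

Variable y : U.
Hypothesis la_inj : forall x x', f x = y -> f x' = y -> phi x != 0 -> phi x' != 0 ->
  la x = la x' -> x = x'.

Lemma cumS_label x : f x = y -> phi x != 0 ->
  cum (la x).+1 y = cum (la x) y + phi x.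
Proof.
move=> fx px; rewrite cumS; congr (_ + _).
rewrite -fx (push_eq1 (x := x))//= ?eqxx// => x' _ fx'.
by case: (la x' =P la x) => // lx' px'; apply: la_inj => //; rewrite fx'.
Qed.

Lemma rank_bound x : f x = y -> phi x != 0 ->
  cum (la x) y + phi x <= push setT f phi y.
Proof. by move=> fx px; rewrite -cumS_label//; exact: cum_le_push. Qed.

Lemma rank_exists (q : int) : 0 <= q < push setT f phi y ->
  exists x, f x = y /\ cum (la x) y <= q < cum (la x) y + phi x.
Proof.
move=> /andP[q0 qlt].
have exn : exists n, q < cum n y.
  have [l [ul _ ls]] := push_ffin y ffin.
  (* One more than the sum of the labels exceeds each of them, so the whole weight of the fibre is
     counted. *)
  exists (\sum_(x <- l) la x).+1.
  suff -> : cum (\sum_(x <- l) la x).+1 y = push setT f phi y by [].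
  rewrite /cum !(push_seq ul)//; last first.
    by move=> x _ fx; case: ifP => // _ px; exact: ls.
  rewrite big_seq_cond [RHS]big_seq_cond; apply: eq_bigr => x /andP[xl _].
  by rewrite ltnS (big_rem x)//= leq_addr.
(* At the least bound [n.+1] the cumulated weight passes [q], so a point of label [n] carries weight
   and its interval contains [q]. *)
case: (ex_minnP exn) => -[|n] qn minn.
  by move: qn; rewrite /cum push_eq0 ?ltNge ?q0.
have cnq : cum n y <= q by rewrite leNgt; apply/negP => /minn; rewrite ltnn.
have : push setT f (fun x => if la x == n then phi x else 0) y != 0.
  by apply: contraTneq qn => p0; rewrite cumS p0 addr0 -leNgt.
move=> /push_neq0[x [_ fx]]; case: (la x =P n) => // lx px; exists x; split=> //.
by rewrite -cumS_label// lx cnq.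
Qed.

(** Monotonicity of [cum] makes the intervals of distinct labels disjoint, so the labels agree and
    [la_inj] applies. *)
Lemma rank_unique (q : int) x x' : f x = y -> f x' = y ->
  cum (la x) y <= q < cum (la x) y + phi x ->
  cum (la x') y <= q < cum (la x') y + phi x' -> x = x'.
Proof.
move=> fx fx' /andP[lx ux] /andP[lx' ux'].
have px : phi x != 0 by apply: contraTneq ux => ->; rewrite addr0 -leNgt.
have px' : phi x' != 0 by apply: contraTneq ux' => ->; rewrite addr0 -leNgt.
apply: la_inj => //; move: ux ux'; rewrite -!cumS_label// => ux ux'.
case: (ltngtP (la x) (la x')) => // h; have := le_cum y h; lia.
Qed.

End WeightedRank.

(** * Groupoids and boundaries *)

Section GroupoidAlgebra.
Variables (G : topologicalType) (mul : G -> G -> G) (inv : G -> G) (r s : G -> G).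
Hypothesis gG : is_groupoid mul inv r s.

Lemma g_rr g : r (r g) = r g. Proof. by case: gG => /(_ g)[]. Qed.
Lemma g_sr g : s (r g) = r g. Proof. by case: gG => /(_ g)[_ []]. Qed.
Lemma g_rs g : r (s g) = s g. Proof. by case: gG => /(_ g)[_ [_ []]]. Qed.
Lemma g_ss g : s (s g) = s g. Proof. by case: gG => /(_ g)[_ [_ []]]. Qed.
Lemma g_rM g h : s g = r h -> r (mul g h) = r g.
Proof. by case: gG => _ H _ _ _ /H[]. Qed.
Lemma g_sM g h : s g = r h -> s (mul g h) = s h.
Proof. by case: gG => _ H _ _ _ /H[]. Qed.
Lemma g_mulA g h k : s g = r h -> s h = r k -> mul (mul g h) k = mul g (mul h k).
Proof. by case: gG => _ _ H _ _; exact: H. Qed.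
Lemma g_mul1 g : mul (r g) g = g. Proof. by case: gG => _ _ _ /(_ g)[]. Qed.
Lemma g_mulr1 g : mul g (s g) = g. Proof. by case: gG => _ _ _ /(_ g)[]. Qed.
Lemma g_rV g : r (inv g) = s g. Proof. by case: gG => _ _ _ _ /(_ g)[]. Qed.
Lemma g_sV g : s (inv g) = r g. Proof. by case: gG => _ _ _ _ /(_ g)[]. Qed.
Lemma g_mulV g : mul g (inv g) = r g. Proof. by case: gG => _ _ _ _ /(_ g)[]. Qed.
Lemma g_mulVg g : mul (inv g) g = s g. Proof. by case: gG => _ _ _ _ /(_ g)[]. Qed.

Lemma g_mulK g h : s g = r h -> mul (mul g h) (inv h) = g.
Proof. by move=> gh; rewrite g_mulA ?g_rV// g_mulV -gh g_mulr1. Qed.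

Lemma g_mulVK g h : s g = s h -> mul (mul g (inv h)) h = g.
Proof. by move=> gh; rewrite g_mulA ?g_rV ?g_sV// g_mulVg -gh g_mulr1. Qed.

Lemma g_Kmul g h : s g = r h -> mul (inv g) (mul g h) = h.
Proof. by move=> gh; rewrite -g_mulA ?g_sV// g_mulVg gh g_mul1. Qed.

Lemma g_invK g : inv (inv g) = g.
Proof.
by rewrite -[RHS](@g_Kmul (inv g)) ?g_sV// g_mulVg -(g_rV g) -g_sV g_mulr1.
Qed.

Lemma unitP x : unit_space r x <-> r x = x.
Proof. by split=> [[y _ <-]|<-]; [rewrite g_rr | exists x]. Qed.

Lemma unit_r g : unit_space r (r g). Proof. by exists g. Qed.
Lemma unit_s g : unit_space r (s g). Proof. by exists (s g); rewrite ?g_rs. Qed.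

Lemma unit_sE x : unit_space r x -> s x = x.
Proof. by move=> /unitP <-; rewrite g_sr. Qed.

Lemma unit_rE x : unit_space r x -> r x = x.
Proof. by move=> /unitP. Qed.

Lemma unit_inv x : unit_space r x -> inv x = x.
Proof.
by move=> ux; rewrite -[LHS]g_mulr1 g_sV unit_rE// g_mulVg unit_sE.
Qed.

Lemma g_invM g h : s g = r h -> inv (mul g h) = mul (inv h) (inv g).
Proof.
move=> gh; have e : s (inv (mul g h)) = r g by rewrite g_sV g_rM.
rewrite -[LHS](@g_mulK _ g)//; congr (mul _ (inv g)).
rewrite -[LHS](@g_mulK _ h) ?g_sM//.
by rewrite (g_mulA e gh) g_mulVg g_sM// -(g_rV h) g_mul1.
Qed.

(** Identifies the pairs with unit product as the pairs [(a, inv a)], which carry the chain of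
    [boundary_inv]. *)
Lemma mul_unit_inv a b : s a = r b -> unit_space r (mul a b) -> b = inv a.
Proof.
move=> ab uab; have rsa : r a = s b.
  by rewrite -(g_rM ab) -(g_sM ab) unit_rE// unit_sE.
rewrite -(g_Kmul ab) -(unit_rE uab) g_rM//.
by rewrite -(g_sV a) g_mulr1.
Qed.

End GroupoidAlgebra.

(** Images of small open sets are given as relatively open in [E]; since [E] is open, they are
    open. *)
Lemma local_homeo_etale (T : topologicalType) (E : set T) (f : T -> T) :
  open E -> local_homeo_onto E f -> etale f.
Proof.
move=> oE [_ lf]; split=> [x|O oO|x].
- have [V [oV Vx _ cV _]] := lf x.
  by move: cV; rewrite continuous_open_subspace// => /(_ x); apply; rewrite inE.
- rewrite openE => _ [x Ox <-]; have [V [oV Vx _ _ opV]] := lf x.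
  have [||W [oW fW]] := opV (O `&` V); first exact: openI.
    by move=> z [].
  have : nbhs (f x) (W `&` E).
    by apply: open_nbhs_nbhs; split; [exact: openI | rewrite -fW; exists x].
  by apply: filterS; rewrite -fW => _ [z [Oz _] <-]; exists z.
- by have [V [oV Vx iV _ _]] := lf x; exists V.
Qed.

Lemma etale_comp_involution (T U : topologicalType) (f : T -> U) (i : T -> T) :
  continuous i -> involutive i -> etale f -> etale (f \o i).
Proof.
move=> ci iK [cf opf lif]; split=> [x|O oO|x].
- by apply: continuous_comp; [exact: ci | exact: cf].
- have -> : (f \o i) @` O = f @` (i @^-1` O).
    apply/seteqP; split=> _ [x Ox <-]; first by exists (i x) => //=; rewrite iK.
    by exists (i x) => //=; rewrite iK.
  by apply: opf; apply: open_comp => // z _; exact: ci.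
- have [V [oV Vx injV]] := lif (i x); exists (i @^-1` V); split=> //.
    by apply: open_comp => // z _; exact: ci.
  move=> a b; rewrite !inE => /= Va Vb fab; apply: (can_inj iK).
  by apply: injV; rewrite ?inE.
Qed.

(** A clopen set inside the open image of a small neighbourhood lifts through a local inverse of
    [f]. The lift is compact by [etale_compact_preimage], hence closed. *)
Lemma etale_clopen_basis (T : topologicalType) (E : set T) (f : T -> T) :
  hausdorff_space T -> etale f -> range f `<=` E -> compact E -> open E ->
  totally_disconnected E -> clopen_basis T.
Proof.
move=> hT ef fE cE oE tdE x O oO Ox; have [cf opf lif] := ef.
have [V [oV Vx injV]] := lif x.
have Efx : E (f x) by apply: fE; exists x.
have [||B [[oB cB] Bx BE]] := totally_disconnected_clopen hT cE oE tdE
    (O := f @` (O `&` V)) Efx.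
- by apply: opf; exact: openI.
- by exists x.
pose D := (O `&` V) `&` f @^-1` B.
have oD : open D.
  by apply: openI; [exact: openI | apply: open_comp => // z _; exact: cf].
exists D; split=> //; last by move=> z [[]].
split=> //; apply: compact_closed => //.
apply: (etale_compact_preimage ef oD).
  by move=> a b; rewrite !inE => -[[_ Va] _] [[_ Vb] _]; apply: injV; rewrite inE.
have -> : f @` D = B.
  apply/seteqP; split=> [_ [z [_ Bz] <-]//|y By].
  by have [_ [z OVz fz]] := BE y By; exists z => //; split=> //=; rewrite fz.
by apply: (subclosed_compact cB cE) => y /BE[].
Qed.

(** * Boundaries of 2-chains *)

Section Boundary.
Variables (G : topologicalType) (mul : G -> G -> G) (inv : G -> G) (r s : G -> G).
Hypotheses (gG : is_groupoid mul inv r s) (er : etale r) (es : etale s).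
Local Notation comp := (composable r s).

Definition boundary (phi : G -> int) : Prop :=
  exists h : G * G -> int, Cc_on comp h /\ forall g, phi g = delta2 mul r s h g.

(** Fixing a factor confines the other one to a fibre of [r] or [s]; fixing the product confines the
    first factor to a fibre of [r] and the second to a fibre of [s]. These fibres meet the compact
    projections of the support in finite sets. *)
Lemma chain_fiber_finite h : Cc_on comp h ->
  [/\ fiber_finite comp (fun p => p.2) h,
      fiber_finite comp (fun p => mul p.1 p.2) h &
      fiber_finite comp (fun p => p.1) h].
Proof.
move=> [_ _ [K [cK _ K0]]].
have c1 : compact (fst @` K).
  by apply: continuous_compact => //; apply: continuous_subspaceT => z; exact: cvg_fst.
have c2 : compact (snd @` K).
  by apply: continuous_compact => //; apply: continuous_subspaceT => z; exact: cvg_snd.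
have inK p : h p != 0 -> K p.
  by move=> hp; apply: contrapT => /K0 h0; rewrite h0 eqxx in hp.
have fin1 (f : G -> G) y : etale f -> finite_set (fst @` K `&` f @^-1` [set y]).
  by move=> ef; exact: etale_finite.
have fin2 (f : G -> G) y : etale f -> finite_set (snd @` K `&` f @^-1` [set y]).
  by move=> ef; exact: etale_finite.
split=> y.
- apply: (sub_finite_set _ (finite_setX (fin1 s (r y) es) (finite_set1 y))).
  by move=> -[a b] [/= ab <- /inK Kp]; split=> //=; split=> //; exists (a, b).
- apply: (sub_finite_set _ (finite_setX (fin1 r (r y) er) (fin2 s (s y) es))).
  move=> -[a b] [/= ab <- /inK Kp]; split=> /=; split.
  + by exists (a, b).
  + by rewrite /= (g_rM gG ab).
  + by exists (a, b).
  + by rewrite /= (g_sM gG ab).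
- apply: (sub_finite_set _ (finite_setX (finite_set1 y) (fin2 r (s y) er))).
  by move=> -[a b] [/= ab <- /inK Kp]; split=> //=; split=> //; exists (a, b).
Qed.

Lemma boundaryD phi psi :
  boundary phi -> boundary psi -> boundary (fun g => phi g + psi g).
Proof.
move=> [h [Ch hE]] [k [Ck kE]]; exists (fun p => h p + k p); split.
  have [lh h0 [K [cK KD K0]]] := Ch; have [lk k0 [L [cL LD L0]]] := Ck.
  split=> [p Dp|p Dp|].
  - have [N [nN HN]] := lh p Dp; have [M [nM HM]] := lk p Dp.
    exists (N `&` M); split; first exact: filterI.
    by move=> q Dq [Nq Mq]; rewrite HN// HM.
  - by rewrite h0// k0// addr0.
  - exists (K `|` L); split; first exact: compactU.
      by move=> p [/KD|/LD].
    by move=> p /not_orP[/K0 -> /L0 ->]; rewrite addr0.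
move=> g; rewrite hE kE /delta2.
have [h1 h2 h3] := chain_fiber_finite Ch; have [k1 k2 k3] := chain_fiber_finite Ck.
by rewrite !pushD//; lia.
Qed.

Lemma boundaryN phi : boundary phi -> boundary (fun g => - phi g).
Proof.
move=> [h [[lh h0 [K [cK KD K0]]] hE]]; exists (fun p => - h p); split.
  split=> [p Dp|p Dp|].
  - have [N [nN HN]] := lh p Dp; exists N; split=> // q Dq Nq; by rewrite HN.
  - by rewrite h0// oppr0.
  - by exists K; split=> // p /K0 ->; rewrite oppr0.
by move=> g; rewrite hE /delta2 !pushN; lia.
Qed.

(* The 2-chain is the pushforward of phi along theta, whose image is the
   relatively clopen part of the composable pairs cut out by zeta in A. *)
Lemma boundary_push (theta : G -> G * G) (eta zeta : G * G -> G) (A : set G) phi :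
  Cc_on setT phi -> hausdorff_space G -> continuous theta ->
  (forall g, comp (theta g)) -> (forall g, eta (theta g) = g) ->
  {within comp, continuous eta} -> {within comp, continuous zeta} ->
  clopen A -> (forall g, A (zeta (theta g))) ->
  (forall z, comp z -> A (zeta z) -> theta (eta z) = z) ->
  boundary (fun g => push setT (fun x => (theta x).2) phi g
                   - push setT (fun x => mul (theta x).1 (theta x).2) phi g
                   + push setT (fun x => (theta x).1) phi g).
Proof.
move=> Cphi hG ct compt etaK ceta czeta cA At thetaK.
have lphi := Cc_loc_const Cphi.
pose h z := if `[< comp z >] && `[< A (zeta z) >] then phi (eta z) else 0.
have hE x : h (theta x) = phi x.
  by rewrite /h etaK; case: asboolP => [_|/(_ (compt x))//]; case: asboolP => // /(_ (At x)).
exists h; split.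
  split=> [p Dp|p Dp|]; last 1 first.
  - exists (theta @` [set x | phi x != 0]); split.
    + apply: continuous_compact; first exact: continuous_subspaceT.
      exact: Cc_compact.
    + by move=> _ [x _ <-].
    + move=> p np; rewrite /h; case: asboolP => //= Dp; case: asboolP => //= Ap.
      apply/eqP; apply: contraT => pe; exfalso; apply: np.
      by exists (eta p) => //; exact: thetaK.
  - move/subspace_continuousP : ceta => /(_ p Dp) ceta.
    move/subspace_continuousP : czeta => /(_ p Dp) czeta.
    have n1 := ceta _ (lphi (eta p)).
    have n2 := czeta _ (clopen_loc_const cA (zeta p)).
    (* Continuity of [eta] and [zeta] holds only within the composable pairs, so both neighbourhoods
       are conditioned on composability. *)
    exists ([set q | comp q -> phi (eta q) = phi (eta p)] `&`
            [set q | comp q -> `[< A (zeta q) >] = `[< A (zeta p) >]]).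
    split; first by apply: filterI; [exact: n1 | exact: n2].
    move=> q Dq [/(_ Dq) e1 /(_ Dq) e2]; rewrite /h e1 e2.
    by rewrite (asboolT Dq) (asboolT Dp).
  - by rewrite /h; case: asboolP.
have pushE (d : G * G -> G) g : push comp d h g = push setT (d \o theta) phi g.
  rewrite /push.
  (* The chain vanishes off the image of [theta], so the sum can be restricted to that image and
     reindexed by the injective [theta]. *)
  rewrite -(fsbig_widen (theta @` ((d \o theta) @^-1` [set g]))); first last.
  - move=> z [[Dz dz] nz] /=; rewrite /h; case: asboolP => //= _.
    case: asboolP => //= Az; exfalso; apply: nz; exists (eta z); last exact: thetaK.
    by rewrite /= thetaK.
  - by move=> _ [x dx <-].
  rewrite fsbig_image; last by move=> a b _ _ /(congr1 eta); rewrite !etaK.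
  rewrite setTI; apply: eq_fsbigr => x _; exact: hE.
by move=> g; rewrite /delta2 !pushE.
Qed.

End Boundary.

Lemma push_id (T : choiceType) (f : T -> T) (phi : T -> int) :
  (forall x, f x = x) -> push setT f phi = phi.
Proof.
move=> fid; apply/funext => x; rewrite -{1}(fid x); apply: push_eq1 => // x' _.
by rewrite !fid.
Qed.

Lemma push_retract (T : choiceType) (A : set T) (f : T -> T) (phi : T -> int) :
  (forall x, A x -> f x = x) -> (forall x, A (f x)) ->
  (forall x, ~ A x -> phi x = 0) -> push setT f phi = phi.
Proof.
move=> fA Af phiA; apply/funext => g; have [Ag|Ag] := pselect (A g).
  have := @push_eq1 T T setT f phi g I; rewrite fA//.
  apply=> x _ fx phix; rewrite -fx; apply/esym/fA.
  by apply: contrapT => /phiA p0; rewrite p0 eqxx in phix.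
rewrite phiA//; apply: push_eq0 => x _ fx; exfalso; apply: Ag; rewrite -fx.
exact: Af.
Qed.

(** * Boundaries coming from units and from inverses *)

Section Ample.
Variables (G : topologicalType) (mul : G -> G -> G) (inv : G -> G) (r s : G -> G).
Hypotheses (gG : is_groupoid mul inv r s) (hG : hausdorff_space G)
  (bG : clopen_basis G) (er : etale r) (es : etale s)
  (cM : {within composable r s, continuous (fun p : G * G => mul p.1 p.2)})
  (cV : continuous inv)
  (cU : compact (unit_space r)) (oU : open (unit_space r)).

Let clU : clopen (unit_space r).
Proof. by split=> //; exact: compact_closed. Qed.

Let cr : continuous r. Proof. by case: er. Qed.
Let cs : continuous s. Proof. by case: es. Qed.

Let c1 : {within composable r s, continuous (fst : G * G -> G)}.
Proof. by apply: continuous_subspaceT => z; exact: cvg_fst. Qed.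

Let c2 : {within composable r s, continuous (snd : G * G -> G)}.
Proof. by apply: continuous_subspaceT => z; exact: cvg_snd. Qed.

Lemma continuous_pair (T : topologicalType) (a b : T -> G) :
  continuous a -> continuous b -> continuous (fun x => (a x, b x)).
Proof. by move=> ca cb x; apply: cvg_pair; [exact: ca | exact: cb]. Qed.

Lemma continuous_mul (T : topologicalType) (a b : T -> G) :
  continuous a -> continuous b -> (forall x, s (a x) = r (b x)) ->
  continuous (fun x => mul (a x) (b x)).
Proof.
move=> ca cb ab x; move/subspace_continuousP : cM => /(_ (a x, b x) (ab x)) H O nO.
have : nbhs x [set y | composable r s (a y, b y) -> O (mul (a y) (b y))].
  exact: (continuous_pair ca cb (H _ nO)).
by apply: filterS => y /(_ (ab y)).
Qed.

(** For the chain carried by the pairs [(r g, g)], the second factor and the product are both [g]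
    and cancel. What remains is the pushforward by [r], which is [phi] itself. *)
Lemma boundary_unit phi : Cc_on setT phi ->
  (forall g, ~ unit_space r g -> phi g = 0) -> boundary mul r s phi.
Proof.
move=> Cphi phiU.
have := @boundary_push G mul r s (fun g => (r g, g)) snd fst (unit_space r) phi
  Cphi hG (continuous_pair cr (fun x => cvg_id)) (g_sr gG) (fun=> erefl) c2 c1 clU
  (@unit_r G r) _.
have -> : (fun g : G => push setT (fun x : G => (r x, x).2) phi g -
           push setT (fun x => mul (r x, x).1 (r x, x).2) phi g +
           push setT (fun x => (r x, x).1) phi g) = phi.
  apply/funext => g /=; rewrite (push_id (f := fun x => x))//.
  rewrite (push_id (f := fun x => mul (r x) x)); last exact: (g_mul1 gG).
  rewrite subrr add0r (push_retract (A := unit_space r))//.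
    exact: (unit_rE gG).
  exact: unit_r.
apply=> -[a b] /= ab ua; congr (_, _).
by rewrite -ab (unit_sE gG ua).
Qed.

(** The chain carried by the pairs [(g, inv g)] yields the required sum minus the pushforward of
    [phi] by [r]; the latter is supported on units, hence a boundary. *)
Lemma boundary_inv phi : Cc_on setT phi ->
  boundary mul r s (fun g => phi g + phi (inv g)).
Proof.
move=> Cphi.
have Cr : Cc_on setT (push setT r phi) by exact: Cc_push.
have Br : boundary mul r s (push setT r phi).
  apply: boundary_unit => // g ug; apply: push_eq0 => x _ rx.
  by exfalso; apply: ug; rewrite -rx; exact: unit_r.
have muU g : unit_space r (mul g (inv g)) by rewrite (g_mulV gG); exact: unit_r.
have thetaK (z : G * G) : composable r s z -> unit_space r (mul z.1 z.2) ->
    (z.1, inv z.1) = z.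
  by case: z => a b /= ab uab; rewrite -(mul_unit_inv gG ab uab).
have := @boundary_push G mul r s (fun g => (g, inv g)) fst (fun p => mul p.1 p.2)
  (unit_space r) phi Cphi hG (continuous_pair (fun x => cvg_id) cV)
  (fun g => esym (g_rV gG g)) (fun=> erefl) c1 cM clU muU thetaK.
move=> B; have := boundaryD gG er es B Br.
congr boundary; apply/funext => g /=; rewrite (push_id (f := fun x => x))//.
have -> : push setT (fun x => mul x (inv x)) phi = push setT r phi.
  by congr (push _ _ _); apply/funext => x; rewrite (g_mulV gG).
have -> : push setT inv phi g = phi (inv g).
  have := @push_eq1 G G setT inv phi (inv g) I; rewrite (g_invK gG).
  by apply=> x _ /(congr1 inv); rewrite (g_invK gG).
by rewrite addrAC subrK addrC.
Qed.

End Ample.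

(** * Elementary subgroupoids *)

Section Elementary.
Variables (G : topologicalType) (mul : G -> G -> G) (inv : G -> G) (r s : G -> G).
Hypotheses (gG : is_groupoid mul inv r s) (hG : hausdorff_space G)
  (bG : clopen_basis G) (er : etale r) (es : etale s)
  (cM : {within composable r s, continuous (fun p : G * G => mul p.1 p.2)})
  (cV : continuous inv)
  (cU : compact (unit_space r)) (oU : open (unit_space r)).
Variable K : set G.
Hypothesis eK : elementary mul inv r s K.

Let cr : continuous r. Proof. by case: er. Qed.
Let cs : continuous s. Proof. by case: es. Qed.

Lemma elem_compact : compact K. Proof. by case: eK. Qed.
Lemma elem_open : open K. Proof. by case: eK => _ []. Qed.
Lemma elem_mul g h : K g -> K h -> s g = r h -> K (mul g h).
Proof. by case: eK => _ [_ [H _ _ _]]; exact: H. Qed.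
Lemma elem_inv g : K g -> K (inv g).
Proof. by case: eK => _ [_ [_ H _ _]]; exact: H. Qed.
Lemma elem_iso k : K k -> r k = s k -> unit_space r k.
Proof. by case: eK => _ [_ [_ _ _ H]]; exact: H. Qed.

Lemma elem_unit x : unit_space r x -> K x.
Proof.
case: eK => _ [_ [_ _ <- _]] [k Kk <-]; rewrite -(g_mulV gG).
by apply: elem_mul => //; [exact: elem_inv | rewrite (g_rV gG)].
Qed.

(** The product [mul k (inv k')] has equal range and source, so principality makes it a unit. *)
Lemma elem_uniq k k' : K k -> K k' -> s k = s k' -> r k = r k' -> k = k'.
Proof.
move=> Kk Kk' skk rkk; have ck : s k = r (inv k') by rewrite (g_rV gG).
have uk : unit_space r (mul k (inv k')).
  apply: elem_iso; first by apply: elem_mul => //; exact: elem_inv.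
  by rewrite (g_rM gG)// (g_sM gG)// (g_sV gG).
rewrite -(g_mulVK gG skk) -(unit_rE gG uk) (g_rM gG)// rkk.
exact: g_mul1 gG _.
Qed.

(* A filter of clopen neighbourhoods of x whose traces on K minus the units
   were all nonempty would cluster at some k with r k = s k = x. *)
Lemma elem_label_exists : exists la : G -> nat, loc_const la /\
  forall k, K k -> la (r k) = la (s k) -> r k = s k.
Proof.
have clU : closed (unit_space r) by exact: compact_closed.
have sep x y : x <> y -> exists D : set G, [/\ clopen D, D x & ~ D y].
  move=> xy; have [||D [cD Dx Dy]] := @bG x (~` [set y]) => //.
    by apply: closed_openC; apply: compact_closed => //; exact: compact_set1.
  by exists D; split=> // /Dy /(_ erefl).
have [|n [la [lla _ sepla]]] := @compact_label G (unit_space r)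
    (fun A => forall k, K k -> A (r k) -> A (s k) -> r k = s k) cU.
  move=> x ux; apply: contrapT => noA.
  pose K' := K `\` unit_space r.
  have cK' : compact K'.
    apply: (@subclosed_compact _ _ K); [|exact: elem_compact|by move=> z []].
    by apply: closedI; [exact: compact_closed elem_compact | exact: open_closedC].
  pose F := filter_from [set D : set G | clopen D /\ D x]
    (fun D => [set k | [/\ K' k, D (r k) & D (s k)]]).
  have FF : Filter F.
    apply: filter_from_filter; first by exists setT; split=> //; exact: clopenT.
    move=> B C [cB Bx] [cC Cx]; exists (B `&` C); first by split=> //; exact: clopenI.
    by move=> z [? [? ?] [? ?]].
  have PF : ProperFilter F.
    apply: filter_from_proper => // D [cD Dx]; apply: contrapT => /nonemptyPn D0.
    apply: noA; exists D; split=> // k Kk Drk Dsk; apply: contrapT => rs.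
    suff : set0 k by [].
    rewrite -D0; split=> //; split=> // uk; apply: rs.
    by rewrite (unit_rE gG uk) (unit_sE gG uk).
  have FK : F K' by exists setT; [split=> //; exact: clopenT | move=> z []].
  have [k [[Kk nuk] clk]] := cK' F PF FK.
  have contra (f : G -> G) : continuous f -> (forall D z, D (r z) -> D (s z) -> D (f z)) ->
      x <> f k -> False.
    move=> cf fsub xf; have [D [[oD cD] Dx Dfk]] := sep _ _ xf.
    have [||z [[_ Dr Ds] nDz]] := clk [set z | [/\ K' z, D (r z) & D (s z)]] (f @^-1` (~` D)).
    - by exists D.
    - by apply: cf; apply: open_nbhs_nbhs; split=> //; exact: closed_openC.
    - by apply: nDz; exact: fsub.
  apply: nuk; apply: elem_iso => //; transitivity x; last first.
    by apply: contrapT => /(@contra s cs); apply.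
  by apply: contrapT => rx; apply: (@contra r cr) => // xr; exact: rx.
exists la; split=> // k Kk lk.
have [A [HA Ar As]] := sepla _ _ (unit_r r k) (unit_s gG k) lk.
exact: HA.
Qed.

(** * Heights in the orbits of an elementary subgroupoid *)

Variable la : G -> nat.
Hypotheses (lla : loc_const la)
  (laK : forall k, K k -> la (r k) = la (s k) -> r k = s k).

Local Notation iK := (indic K).
Local Notation cumK := (cum s iK (la \o r)).

Let iK_Cc : Cc_on setT iK.
Proof. by apply: Cc_indic => //; [exact: elem_compact | exact: elem_open]. Qed.

Let iK_ffin : fiber_finite setT s iK.
Proof. exact: Cc_fiber_finite. Qed.

Let iK_ge0 g : 0 <= iK g. Proof. by rewrite /indic; case: ifP. Qed.

Let iK1 g : K g -> iK g = 1. Proof. by rewrite /indic => /asboolT ->. Qed.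

Let iKN g : iK g != 0 -> K g. Proof. by rewrite /indic; case: asboolP. Qed.

(* The position, starting from 0, of x in its K-orbit ordered by la. *)
Definition height (x : G) : int := cumK (la x) x.
(** This counts the elements of [K] with source [x]; by principality it is the cardinality of the
    orbit. *)
Definition orbit_size (x : G) : int := push setT s iK x.

Let la_inj y x x' : s x = y -> s x' = y -> iK x != 0 -> iK x' != 0 ->
  la (r x) = la (r x') -> x = x'.
Proof.
move=> <- sx /iKN Kx /iKN Kx' lxx; apply: elem_uniq => //.
have c : s x = r (inv x') by rewrite (g_rV gG).
rewrite -(g_rM gG c) (laK (k := mul x (inv x')))//.
- by rewrite (g_sM gG)// (g_sV gG).
- by apply: elem_mul => //; exact: elem_inv.
- by rewrite (g_rM gG)// (g_sM gG)// (g_sV gG).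
Qed.

(** Right translation by [k] is a bijection between the two fibres of [s], inverted by right
    translation by [inv k]. *)
Lemma push_shift (phi : G -> int) k :
  (forall x, s x = r k -> phi (mul x k) = phi x) ->
  push setT s phi (r k) = push setT s phi (s k).
Proof.
move=> phik; rewrite /push.
rewrite (@reindex_fsbig _ _ _ _ _ (fun x => mul x k)
  (setT `&` s @^-1` [set r k]) (setT `&` s @^-1` [set s k])).
  by apply: eq_fsbigr => x; rewrite inE => -[_ /= sx]; rewrite phik.
split.
- by move=> x [_ /= sx]; split=> //=; rewrite (g_sM gG).
- move=> x x'; rewrite !inE => -[_ /= sx] [_ /= sx'] e.
  by rewrite -(g_mulK gG sx) e (g_mulK gG sx').
- move=> x [_ /= sx]; exists (mul x (inv k)); last exact: (g_mulVK gG sx).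
  by split=> //=; rewrite (g_sM gG) ?(g_sV gG)// (g_rV gG).
Qed.

Lemma elem_mulr x k : K k -> s x = r k -> K (mul x k) <-> K x.
Proof.
move=> Kk xk; split=> [Kxk|Kx]; last exact: elem_mul.
rewrite -(g_mulK gG xk); apply: elem_mul => //; first exact: elem_inv.
by rewrite (g_sM gG)// (g_rV gG).
Qed.

(** Right translation by [k] preserves ranges and membership in [K]. All points of an orbit can thus
    be ranked in a single fibre of [s]. *)
Lemma cumK_shift n k : K k -> cumK n (r k) = cumK n (s k).
Proof.
move=> Kk; apply: push_shift => x xk /=; rewrite (g_rM gG)//.
by rewrite /indic (propext (elem_mulr Kk xk)).
Qed.

Lemma height_ge0 x : 0 <= height x.
Proof. exact: cum_ge0. Qed.

Lemma height_lt x : unit_space r x -> height x < orbit_size x.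
Proof.
move=> ux; have Kx := elem_unit ux.
have := @rank_bound _ _ s iK (la \o r) iK_ffin iK_ge0 x (@la_inj x) x (unit_sE gG ux).
rewrite (iK1 Kx) /= (unit_rE gG ux) => /(_ isT).
by rewrite /height /orbit_size lezD1.
Qed.

(** The intervals tiling the fibre over [x] have length 1, so the one that contains [q] starts at
    [q]. *)
Lemma height_exists x (q : int) : unit_space r x -> 0 <= q < orbit_size x ->
  exists k, [/\ K k, s k = x & height (r k) = q].
Proof.
move=> ux qN.
have [k [sk /andP[lk uk]]] := rank_exists iK_ffin (@la_inj x) qN.
have Kk : K k.
  by apply: iKN; apply: contraTneq uk => ->; rewrite addr0 -leNgt.
exists k; split=> //; rewrite /height (cumK_shift _ Kk) sk.
move: uk; rewrite (iK1 Kk) ltzD1 => uk.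
by apply/eqP; rewrite eq_le lk uk.
Qed.

(** Both [k] and [s k] lie in the fibre over [s k], and equal heights give them the same interval of
    length 1. *)
Lemma height_inj k : K k -> height (r k) = height (s k) -> k = s k.
Proof.
move=> Kk; rewrite /height (cumK_shift _ Kk) => e.
apply: (rank_unique iK_ffin iK_ge0 (@la_inj (s k)) (q := height (s k))) => //.
- exact: (g_ss gG).
- by rewrite /= e /height (iK1 Kk) lexx /= ltzD1 lexx.
- have Ks : K (s k) by apply: elem_unit; exact: (unit_s gG).
  by rewrite /= (g_rs gG) /height (iK1 Ks) lexx /= ltzD1 lexx.
Qed.

Lemma height_loc_const : loc_const height.
Proof.
have lc n : loc_const (cumK n).
  apply: Cc_loc_const; apply: Cc_push => //; apply: (Cc_supp _ iK_Cc).
    apply: (@loc_const_fun2 G _ _ _ (la \o r) iK (fun i v => if (i < n)%N then v else 0)).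
      exact: loc_const_comp.
    exact: Cc_loc_const.
  by move=> x ->; rewrite if_same.
(* Near [x] the label is constant, which freezes the cut-off in [cum]. *)
by move=> x; apply: filterS2 (lla x) (lc (la x) x) => y; rewrite /height => ->.
Qed.

(** The map [s] sends this set bijectively onto the units: for each unit it holds the element of [K]
    leading to the lowest point of the orbit. It is the image of the section [t] below. *)
Definition base : set G := [set k | K k /\ height (r k) = 0].

Lemma base_clopen : clopen base.
Proof.
apply: clopenI.
  by split; [exact: elem_open | exact: compact_closed elem_compact].
apply: (@loc_const_clopen G _ (height \o r) (fun v => v = 0)).
exact: loc_const_comp height_loc_const.
Qed.

Lemma base_inj k k' : base k -> base k' -> s k = s k' -> k = k'.
Proof.
move=> [Kk hk] [Kk' hk'] skk.
have c : s k = r (inv k') by rewrite (g_rV gG).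
have Kc : K (mul k (inv k')) by apply: elem_mul => //; exact: elem_inv.
have e : mul k (inv k') = s (mul k (inv k')).
  apply: height_inj => //; rewrite (g_rM gG)// (g_sM gG)// (g_sV gG).
  by rewrite hk hk'.
apply: elem_uniq => //.
have := congr1 r e; rewrite (g_rs gG) (g_rM gG)// (g_sM gG)// (g_sV gG).
by [].
Qed.

Lemma base_section_exists : exists t : G -> G,
  forall x, unit_space r x -> base (t x) /\ s (t x) = x.
Proof.
have /choice[t Ht] : forall x, exists k, unit_space r x -> base k /\ s k = x.
  move=> x; have [ux|ux] := pselect (unit_space r x); last by exists x.
  have [|k [Kk sk hk]] := @height_exists x 0 ux; last by exists k.
  by rewrite lexx /=; apply: le_lt_trans (height_lt ux); exact: height_ge0.
by exists t.
Qed.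

Variable t : G -> G.
Hypothesis Ht : forall x, unit_space r x -> base (t x) /\ s (t x) = x.

Lemma t_s x : unit_space r x -> s (t x) = x. Proof. by move=> /Ht[]. Qed.
Lemma t_base x : unit_space r x -> base (t x). Proof. by move=> /Ht[]. Qed.
Lemma t_K x : unit_space r x -> K (t x). Proof. by move=> /Ht[[]]. Qed.
Lemma ts_s g : s (t (s g)) = s g. Proof. by rewrite t_s//; exact: (unit_s gG). Qed.
Lemma tr_s g : s (t (r g)) = r g. Proof. by rewrite t_s//; exact: unit_r. Qed.

Lemma t_uniq k : base k -> t (s k) = k.
Proof.
by move=> bk; apply: base_inj => //; [exact: (t_base (unit_s gG _)) | rewrite ts_s].
Qed.

(** Both sides lie in [base] and have source [s k]. *)
Lemma t_shift k : K k -> t (s k) = mul (t (r k)) k.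
Proof.
move=> Kk; have c : s (t (r k)) = r k by rewrite tr_s.
rewrite -[in LHS](g_sM gG c); apply: t_uniq; split.
  by apply: elem_mul => //; exact/t_K/unit_r.
by rewrite (g_rM gG)//; have [] := t_base (unit_r r k).
Qed.

Lemma t_top x : unit_space r x -> height x = 0 -> t x = x.
Proof.
move=> ux hx; rewrite -{1}(unit_sE gG ux); apply: t_uniq.
by split; [exact: elem_unit | rewrite (unit_rE gG ux)].
Qed.

(** Although chosen pointwise, [t] inverts [s] on the open set [base] by uniqueness, and [s] is
    open. Only values at units are controlled, hence the composition with [f]. *)
Lemma t_continuous (f : G -> G) : continuous f ->
  (forall g, unit_space r (f g)) -> continuous (t \o f).
Proof.
move=> cf fU g O /nbhs_interior nO; have [_ os _] := es.
have [obase _] := base_clopen.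
have : nbhs (f g) (s @` (O^° `&` base)).
  apply: open_nbhs_nbhs; split; first by apply: os; apply: openI => //; exact: open_interior.
  exists (t (f g)); last exact: t_s.
  by split; [exact: nbhs_singleton | exact: t_base].
move=> nf; have : nbhs g (f @^-1` (s @` (O^° `&` base))) by exact: cf.
apply: filterS => h [k [Ok bk] sk] /=.
by rewrite -sk t_uniq//; exact: interior_subset Ok.
Qed.

(** * Moving ranges and sources to the lowest points of orbits *)

Definition rho g := mul (t (r g)) g.
Definition rho' g := mul g (inv (t (s g))).

Let comp_rho g : s (t (r g)) = r g. Proof. exact: tr_s. Qed.
Let comp_rho' g : s g = r (inv (t (s g))). Proof. by rewrite (g_rV gG) ts_s. Qed.

Lemma s_rho g : s (rho g) = s g. Proof. exact: (g_sM gG (comp_rho g)). Qed.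
Lemma r_rho g : r (rho g) = r (t (r g)). Proof. exact: (g_rM gG (comp_rho g)). Qed.
Lemma r_rho' g : r (rho' g) = r g. Proof. exact: (g_rM gG (comp_rho' g)). Qed.
Lemma s_rho' g : s (rho' g) = r (t (s g)). Proof. by rewrite (g_sM gG)// (g_sV gG). Qed.

Lemma tr_continuous : continuous (t \o r).
Proof. by apply: t_continuous => // g; exact: unit_r. Qed.
Lemma ts_continuous : continuous (t \o s).
Proof. by apply: t_continuous => // g; exact: (unit_s gG). Qed.

Lemma rho_etale : etale rho.
Proof.
apply: (etale_factor (q := s)) => //.
  exact: (continuous_mul cM tr_continuous (fun x => cvg_id)).
by have -> : s \o rho = s by apply/funext => g; exact: s_rho.
Qed.

Lemma rho'_etale : etale rho'.
Proof.
apply: (etale_factor (q := r)) => //.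
  apply: (continuous_mul cM (fun x => cvg_id)) => // x.
  by apply: continuous_comp; [exact: ts_continuous | exact: cV].
by have -> : r \o rho' = r by apply/funext => g; exact: r_rho'.
Qed.

Lemma tr_etale : etale (t \o r).
Proof.
apply: (etale_factor (q := s)) => //; first exact: tr_continuous.
by have -> : s \o (t \o r) = r by apply/funext => g; exact: tr_s.
Qed.

Lemma ts_etale : etale (t \o s).
Proof.
apply: (etale_factor (q := s)) => //; first exact: ts_continuous.
by have -> : s \o (t \o s) = s by apply/funext => g; exact: ts_s.
Qed.

(** The chain is carried by the pairs [(rho' g, t (s g))], whose product is [g]; these are the
    composable pairs with second factor in [base]. *)
Lemma boundary_rho' phi : Cc_on setT phi -> boundary mul r s
  (fun g => push setT (t \o s) phi g - phi g + push setT rho' phi g).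
Proof.
move=> Cphi.
have c2 : {within composable r s, continuous (snd : G * G -> G)}.
  by apply: continuous_subspaceT => z; exact: cvg_snd.
have [crho' _ _] := rho'_etale.
have rho'K g : mul (rho' g) (t (s g)) = g by apply: (g_mulVK gG); rewrite ts_s.
have := @boundary_push G mul r s (fun g => (rho' g, t (s g)))
  (fun p => mul p.1 p.2) snd base phi Cphi hG (continuous_pair crho' ts_continuous)
  s_rho' rho'K cM c2 base_clopen (fun g => t_base (unit_s gG g)).
have -> : push setT (fun x => mul (rho' x, t (s x)).1 (rho' x, t (s x)).2) phi = phi.
  exact: push_id.
apply=> -[a b] /= ab bb; rewrite /rho' (g_sM gG ab) (t_uniq bb).
by rewrite (g_mulK gG ab).
Qed.

(** The chain is carried by the pairs [(t (r g), g)], the composable pairs with first factor in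
    [base]. *)
Lemma boundary_rho phi : Cc_on setT phi -> boundary mul r s
  (fun g => phi g - push setT rho phi g + push setT (t \o r) phi g).
Proof.
move=> Cphi.
have c1 : {within composable r s, continuous (fst : G * G -> G)}.
  by apply: continuous_subspaceT => z; exact: cvg_fst.
have c2 : {within composable r s, continuous (snd : G * G -> G)}.
  by apply: continuous_subspaceT => z; exact: cvg_snd.
have := @boundary_push G mul r s (fun g => (t (r g), g)) snd fst base phi Cphi hG
  (continuous_pair tr_continuous (fun x => cvg_id)) comp_rho (fun=> erefl) c2 c1
  base_clopen (fun g => t_base (unit_r r g)).
have -> : push setT (fun x => (t (r x), x).2) phi = phi by exact: push_id.
apply=> -[a b] /= ab ba; congr (_, _).
by rewrite -ab (t_uniq ba).
Qed.

(** [boundary_rho'] is used for [phi] and [boundary_rho] for its pushforward along [rho']. As [rho']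
    preserves ranges, the leftover terms are the pushforwards of [phi] along [t \o s] and [t \o r],
    which agree for a cycle. *)
Lemma boundary_cycle phi : Cc_on setT phi -> push setT r phi = push setT s phi ->
  boundary mul r s (fun g => phi g - push setT rho (push setT rho' phi) g).
Proof.
move=> Cphi cyc.
have Cphi' : Cc_on setT (push setT rho' phi) by apply: Cc_push => //; exact: rho'_etale.
have := boundaryD gG er es (boundaryN (boundary_rho' Cphi)) (boundary_rho Cphi').
congr boundary; apply/funext => g.
have -> : push setT (t \o r) (push setT rho' phi) g = push setT (t \o s) phi g.
  have e : (t \o r) \o rho' = t \o r by apply/funext => h /=; rewrite r_rho'.
  rewrite push_comp; last by rewrite e; apply: Cc_fiber_finite => //; exact: tr_etale.
  rewrite e -push_comp ?cyc ?push_comp//; apply: Cc_fiber_finite => //.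
    exact: ts_etale.
  exact: tr_etale.
lia.
Qed.


Definition pi g := rho (rho' g).

Lemma pi_etale : etale pi.
Proof. by apply: (@etale_comp _ _ _ rho' rho); [exact: rho'_etale | exact: rho_etale]. Qed.

Lemma s_pi g : s (pi g) = r (t (s g)). Proof. by rewrite /pi s_rho s_rho'. Qed.
Lemma r_pi g : r (pi g) = r (t (r g)). Proof. by rewrite /pi r_rho r_rho'. Qed.

Lemma piE g : pi g = mul (t (r g)) (mul g (inv (t (s g)))).
Proof. by rewrite /pi /rho r_rho'. Qed.

Lemma pi_recover w : w = mul (mul (inv (t (r w))) (pi w)) (t (s w)).
Proof.
rewrite piE (g_Kmul gG); last by rewrite tr_s; exact: (esym (r_rho' w)).
by rewrite (g_mulVK gG)// ts_s.
Qed.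

Lemma pi_inj w w' : pi w = pi w' -> s w = s w' -> r w = r w' -> w = w'.
Proof. by move=> e es' er'; rewrite (pi_recover w) (pi_recover w') e es' er'. Qed.

Lemma pi_inv g : pi (inv g) = inv (pi g).
Proof.
have c : s (t (r g)) = r (mul g (inv (t (s g)))) by rewrite tr_s; exact: (esym (r_rho' g)).
rewrite !piE (g_rV gG) (g_sV gG) (g_invM gG)// (g_invM gG)// (g_invK gG).
by rewrite (g_mulA gG)// ?(g_rV gG) ?ts_s// (g_sV gG) tr_s.
Qed.

Lemma height_rt x : unit_space r x -> height (r (t x)) = 0.
Proof. by move=> /t_base[]. Qed.

(** Here [pi k] stays in [K] and runs from a lowest point to itself, so principality applies. *)
Lemma pi_unit k : K k -> unit_space r (pi k).
Proof.
move=> Kk; have Ks := t_K (unit_s gG k); have Kr := t_K (unit_r r k).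
have cs' : s k = r (inv (t (s k))) by rewrite (g_rV gG) ts_s.
apply: elem_iso; last first.
  by rewrite s_pi r_pi (t_shift Kk) (g_rM gG)// tr_s.
rewrite piE; apply: elem_mul => //; last by rewrite (g_rM gG)// tr_s.
by apply: elem_mul => //; exact: elem_inv.
Qed.

(** The element [mul (inv (t x')) (t x)] of [K] runs from [x] to [x']; equal heights at its ends
    make it a unit. *)
Lemma same_height x x' : unit_space r x -> unit_space r x' ->
  r (t x) = r (t x') -> height x = height x' -> x = x'.
Proof.
move=> ux ux' e hx; have c : s (inv (t x')) = r (t x) by rewrite (g_sV gG).
have Kk : K (mul (inv (t x')) (t x)).
  by apply: elem_mul => //; [apply: elem_inv; exact: t_K | exact: t_K].
have rk : r (mul (inv (t x')) (t x)) = x' by rewrite (g_rM gG)// (g_rV gG) t_s.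
have sk : s (mul (inv (t x')) (t x)) = x by rewrite (g_sM gG)// t_s.
have := height_inj Kk; rewrite rk sk hx => /(_ erefl) /(congr1 r).
by rewrite rk (unit_rE gG ux).
Qed.

(** Lifts [g] to an arrow with prescribed ends. Since [s k] and [s k'] are lowest points, [t] takes
    the values [inv k] and [inv k'] at those ends, so [pi] strips off [k] and [k']. *)
Lemma pi_build k g k' : K k -> K k' -> s k = r g -> s k' = s g ->
  height (r g) = 0 -> height (s g) = 0 ->
  let w := mul (mul k g) (inv k') in [/\ r w = r k, s w = r k' & pi w = g].
Proof.
move=> Kk Kk' kg k'g hr hs w.
have tdown l : K l -> height (s l) = 0 -> t (r l) = inv l.
  move=> Kl hl; rewrite -(g_sV gG l); apply: t_uniq.
  by split; [exact: elem_inv | rewrite (g_rV gG)].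
have c : s (mul k g) = r (inv k') by rewrite (g_sM gG)// (g_rV gG).
have rw : r w = r k by rewrite /w (g_rM gG)// (g_rM gG).
have sw : s w = r k' by rewrite /w (g_sM gG)// (g_sV gG).
split=> //; rewrite piE rw sw !tdown ?kg ?k'g// (g_invK gG) /w.
by rewrite (g_mulVK gG) ?(g_sM gG)// (g_Kmul gG).
Qed.

(* The intervals [a g, a g + om g) are to tile [0, m (s g)) when s g is fixed,
   and the intervals [b g, b g + om g) to tile [0, m (r g)) when r g is fixed. *)
Section Pack.
Variables (om a b m : G -> int).

(** The common offset [j] at both ends gives [om g] distinct lifts of [g]; the units fill the
    heights from [m] upwards, which the lifts leave free. *)
Definition pack : set G :=
  [set w | exists j : int, [/\ 0 <= j, j < om (pi w),
     height (s w) = a (pi w) + j & height (r w) = b (pi w) + j]]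
  `|` [set x | unit_space r x /\ m (r (t x)) <= height x].

Hypotheses
  (om_base : forall g, om g != 0 -> height (r g) = 0 /\ height (s g) = 0)
  (om_bound : forall g, om g != 0 -> [/\ 0 <= a g, a g + om g <= m (s g),
                                       0 <= b g & b g + om g <= m (r g)])
  (m_size : forall y, unit_space r y -> height y = 0 -> m y <= orbit_size y).

Let om_neq0 (j : int) g : 0 <= j -> j < om g -> om g != 0.
Proof. by move=> j0 jg; apply: contraTneq jg => ->; rewrite -leNgt. Qed.

Lemma pack_build g (j : int) : 0 <= j -> j < om g ->
  exists w, [/\ pi w = g, height (s w) = a g + j & height (r w) = b g + j].
Proof.
move=> j0 jg; have g0 := om_neq0 j0 jg.
have [hr hs] := om_base g0; have [a0 am b0 bm] := om_bound g0.
have mr := m_size (unit_r r g) hr; have ms := m_size (unit_s gG g) hs.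
have [|k [Kk sk hk]] := @height_exists (r g) (b g + j) (unit_r r g).
  by apply/andP; split; lia.
have [|k' [Kk' sk' hk']] := @height_exists (s g) (a g + j) (unit_s gG g).
  by apply/andP; split; lia.
have [rw sw pw] := pi_build Kk Kk' sk sk' hr hs.
by exists (mul (mul k g) (inv k')); rewrite rw sw pw.
Qed.

(** A unit below height [m] falls in the tile of some [g]; the offset [height x - a g] selects a
    lift, whose source is [x] by [same_height]. *)
Lemma pack_surj :
  (forall y (q : int), unit_space r y -> height y = 0 -> 0 <= q < m y ->
     exists g, s g = y /\ a g <= q < a g + om g) ->
  s @` pack = unit_space r.
Proof.
move=> sur; apply/seteqP; split=> [_ [w _ <-]|x ux]; first exact: (unit_s gG).
have [mx|xm] := leP (m (r (t x))) (height x).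
  by exists x; [right | exact: (unit_sE gG)].
have [||g [sg /andP[lg ug]]] := sur (r (t x)) (height x) (unit_r r (t x)).
- exact: height_rt.
- by rewrite height_ge0.
have [||w [pw hs hr]] := @pack_build g (height x - a g); [lia|lia|].
exists w; first by left; exists (height x - a g); rewrite pw; split=> //; lia.
apply: same_height => //; first exact: (unit_s gG).
  by rewrite -s_pi pw sg.
by rewrite hs; lia.
Qed.

(** Sources of lifts have height below [m], so they avoid the added units. Two lifts with a common
    source lie over the same [g] with the same offset, hence share their range and agree by
    [pi_inj]. *)
Lemma pack_inj :
  (forall g g' (q : int), s g = s g' -> a g <= q < a g + om g ->
     a g' <= q < a g' + om g' -> g = g') ->
  {in pack &, injective s}.
Proof.
move=> inj.
have mixed w x : (exists j : int, [/\ 0 <= j, j < om (pi w),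
     height (s w) = a (pi w) + j & height (r w) = b (pi w) + j]) ->
     unit_space r x -> m (r (t x)) <= height x -> s w = x -> False.
  move=> [j [j0 jg hs _]] ux mx swx; have := om_bound (om_neq0 j0 jg).
  by rewrite s_pi swx => -[_ am _ _]; move: hs; rewrite swx; lia.
move=> w w'; rewrite !inE => -[Ww|[uw mw]] [Ww'|[uw' mw']] sww.
- have [j [j0 jg hs hr]] := Ww; have [j' [j0' jg' hs' hr']] := Ww'.
  have e : pi w = pi w'.
    apply: (inj _ _ (height (s w))); first by rewrite !s_pi sww.
      by apply/andP; split; lia.
    by rewrite sww; apply/andP; split; lia.
  apply: pi_inj => //; apply: same_height; [exact: unit_r|exact: unit_r| |].
    by rewrite -!r_pi e.
  by rewrite hr hr' e; move: hs hs'; rewrite sww e; lia.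
- by exfalso; apply: (mixed w w') => //; rewrite sww (unit_sE gG uw').
- by exfalso; apply: (mixed w' w) => //; rewrite -sww (unit_sE gG uw).
- by rewrite -(unit_sE gG uw) -(unit_sE gG uw').
Qed.

(** All the numbers in the conditions are constant near the point considered, so the same offset
    serves nearby arrows. *)
Lemma pack_open : loc_const om -> loc_const m ->
  (forall g, om g != 0 -> \forall h \near g, a h = a g /\ b h = b g) ->
  open pack.
Proof.
move=> lom lm lab.
have lh := height_loc_const; have [cpi _ _] := pi_etale.
rewrite openE => w [[j [j0 jg hs hr]]|[uw mw]].
  have n1 : nbhs w (pi @^-1` [set h | a h = a (pi w) /\ b h = b (pi w)]).
    by apply: cpi; apply: lab; exact: om_neq0 jg.
  have n2 : nbhs w (pi @^-1` [set h | om h = om (pi w)]) by apply: cpi; exact: lom.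
  have n3 : nbhs w (s @^-1` [set h | height h = height (s w)]) by apply: cs; exact: lh.
  have n4 : nbhs w (r @^-1` [set h | height h = height (r w)]) by apply: cr; exact: lh.
  apply: filterS (filterI (filterI n1 n2) (filterI n3 n4)).
  move=> v [[/= [e1 e2] e3] [e4 e5]]; left; exists j.
  by rewrite e1 e2 e3 e4 e5.
have n1 : nbhs w (unit_space r) by exact: open_nbhs_nbhs.
have n2 : nbhs w ((t \o r) @^-1` (r @^-1` [set h | m h = m (r (t (r w)))])).
  by apply: tr_continuous; apply: cr; exact: lm.
apply: filterS (filterI (filterI n1 n2) (lh w)) => v [[uv /= e1] e2]; right; split=> //.
by rewrite e2; move: e1; rewrite (unit_rE gG uw) (unit_rE gG uv) => ->.
Qed.

(** Off the units only lifts contribute, because [pi] sends units to units. The lifts of [g] are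
    listed by offset and told apart by the heights of their sources. *)
Lemma pack_count g : ~ unit_space r g -> 0 <= om g ->
  push setT pi (indic pack) g = om g.
Proof.
move=> ug om0.
have /choice[w Hw] : forall j : nat, exists w, (j%:Z < om g) ->
    [/\ pi w = g, height (s w) = a g + j%:Z & height (r w) = b g + j%:Z].
  move=> j; have [jg|jg] := ltP j%:Z (om g); last by exists g.
  by have [//|//|w Hw] := @pack_build g j%:Z; exists w.
pose n := `|om g|%N.
have nE : om g = n%:Z by rewrite /n; lia.
have Hw' j : (j < n)%N -> [/\ pi (w j) = g, height (s (w j)) = a g + j%:Z &
    height (r (w j)) = b g + j%:Z] by move=> jn; apply: Hw; rewrite nE; lia.
have ul : uniq [seq w j | j <- iota 0 n].
  rewrite map_inj_in_uniq ?iota_uniq// => i j; rewrite !mem_iota => /andP[_ ilt] /andP[_ jlt] e.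
  have [_ h1 _] := Hw' i ilt; have [_ h2 _] := Hw' j jlt.
  by move: h1 h2; rewrite e; lia.
rewrite (push_seq ul)//.
  rewrite big_map big_seq_cond.
  transitivity (\sum_(j <- iota 0 n) (1 : int)).
    rewrite [RHS]big_seq; apply: congr_big => // j.
      case: (boolP (j \in iota 0 n)) => //=; rewrite mem_iota => /andP[_ jn].
      by have [-> _ _] := Hw' j jn; rewrite eqxx.
    move=> /andP[]; rewrite mem_iota => /andP[_ jn] _.
    have [pw hs hr] := Hw' j jn; rewrite /indic asboolT//; left.
    by exists j%:Z; rewrite pw; split=> //; rewrite nE; lia.
  by rewrite big_const_seq count_predT size_iota iter_addr_0 nE natz.
move=> x _ px; rewrite /indic; case: asboolP => // -[[j [j0 jg hs hr]]|[ux _]] _; last first.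
  by exfalso; apply: ug; rewrite -px; apply: pi_unit; exact: elem_unit.
rewrite px in jg hs hr.
have jn : (`|j| < n)%N by lia.
have [pw hs' hr'] := Hw' _ jn.
have -> : x = w `|j|%N.
  apply: pi_inj; first by rewrite pw.
    apply: same_height; [exact: (unit_s gG)|exact: (unit_s gG)| |].
      by rewrite -!s_pi pw px.
    by rewrite hs hs'; lia.
  apply: same_height; [exact: unit_r|exact: unit_r| |].
    by rewrite -!r_pi pw px.
  by rewrite hr hr'; lia.
by apply: map_f; rewrite mem_iota.
Qed.

End Pack.

(** Inversion exchanges [a] and [b], so facts about [r] on a pack follow from facts about [s]. *)
Lemma pack_inv om a b m w :
  pack om a b m (inv w) <-> pack (om \o inv) (b \o inv) (a \o inv) m w.
Proof.
have ui x : unit_space r x -> unit_space r (inv x) by move=> ux; rewrite (unit_inv gG).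
rewrite /pack /= pi_inv (g_sV gG) (g_rV gG); split=> -[[j [? ? ? ?]]|[uw mw]].
- by left; exists j.
- have uw' : unit_space r w by rewrite -(g_invK gG w); exact: ui.
  by right; split=> //; move: mw; rewrite (unit_inv gG uw').
- by left; exists j.
- by right; rewrite (unit_inv gG uw).
Qed.

(** * The full bisection attached to a nonnegative cycle *)

Section Cycle.
Variable F : G -> int.
Hypotheses (CF : Cc_on setT F) (F0 : forall g, 0 <= F g)
  (cycF : push setT r F = push setT s F).

Let psi := push setT pi F.

(** The values at units only contribute boundaries, and keeping them could make the total weight
    exceed the orbit size. *)
Definition offdiag (g : G) : int := if `[< unit_space r g >] then 0 else psi g.

Let Cpsi : Cc_on setT psi. Proof. by apply: Cc_push => //; exact: pi_etale. Qed.

Let clU : clopen (unit_space r).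
Proof. by split=> //; exact: compact_closed. Qed.

Lemma offdiag_Cc : Cc_on setT offdiag.
Proof.
apply: (Cc_supp _ Cpsi); last by move=> x p0; rewrite /offdiag p0 if_same.
exact: (@loc_const_fun2 G _ _ _ _ _ (fun (b : bool) v => if b then 0 else v)
          (clopen_loc_const clU) (Cc_loc_const Cpsi)).
Qed.

Lemma offdiag_ge0 g : 0 <= offdiag g.
Proof. by rewrite /offdiag; case: ifP => // _; exact: push_ge0. Qed.

Lemma offdiag_base g : offdiag g != 0 -> height (r g) = 0 /\ height (s g) = 0.
Proof.
rewrite /offdiag; case: asboolP => // _ /push_neq0[e [_ <- _]].
by rewrite r_pi s_pi; split; apply: height_rt; [exact: unit_r | exact: (unit_s gG)].
Qed.

(** The pushforward of [F] along [pi] is a cycle because [r \o pi] and [s \o pi] are [r \o t \o r]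
    and [r \o t \o s]. Its part on the units is fixed by both pushforwards and can be subtracted. *)
Lemma offdiag_cycle : push setT r offdiag = push setT s offdiag.
Proof.
pose diag g := if `[< unit_space r g >] then psi g else 0.
have Cdiag : Cc_on setT diag.
  apply: (Cc_supp _ Cpsi); last by move=> x p0; rewrite /diag p0 if_same.
  exact: (@loc_const_fun2 G _ _ _ _ _ (fun (b : bool) v => if b then v else 0)
          (clopen_loc_const clU) (Cc_loc_const Cpsi)).
have diagU g : ~ unit_space r g -> diag g = 0 by rewrite /diag; case: asboolP.
have psiE : psi = fun g => offdiag g + diag g.
  by apply/funext => g; rewrite /offdiag /diag; case: ifP => _; rewrite ?add0r ?addr0.
have split_ (f : G -> G) : etale f -> push setT f diag = diag ->
    push setT f offdiag = fun y => push setT f psi y - diag y.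
  move=> ef fd; apply/funext => y; rewrite [in RHS]psiE pushD ?fd ?addrK//.
    by apply: Cc_fiber_finite => //; exact: offdiag_Cc.
  exact: Cc_fiber_finite.
rewrite !split_//; last 2 first.
- by apply: (push_retract (A := unit_space r)) => //; [exact: (unit_sE gG) | exact: (unit_s gG)].
- by apply: (push_retract (A := unit_space r)) => //; [exact: (unit_rE gG) | exact: unit_r].
suff -> : push setT r psi = push setT s psi by [].
have psi_t (f f' : G -> G) : etale f -> etale f' -> etale (t \o f') ->
    (forall g, f (pi g) = r (t (f' g))) ->
    push setT f psi = push setT r (push setT t (push setT f' F)).
  move=> ef ef' etf' fpi; apply/funext => y.
  have ert : etale (r \o (t \o f')) by exact: etale_comp.
  have e : f \o pi = r \o (t \o f') by apply/funext => g; exact: fpi.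
  rewrite /psi [LHS]push_comp; last by rewrite e; exact: Cc_fiber_finite.
  rewrite e -[LHS]push_comp; last exact: Cc_fiber_finite.
  congr (push _ _ _ _); apply/funext => z; rewrite push_comp//.
  exact: Cc_fiber_finite.
rewrite (psi_t r r)//; [|exact: tr_etale|exact: r_pi].
by rewrite (psi_t s s)//; [rewrite cycF|exact: ts_etale|exact: s_pi].
Qed.

Let msize := push setT s offdiag.

Hypothesis m_size : forall y, unit_space r y -> height y = 0 -> msize y <= orbit_size y.

Lemma cycle_full_Gset : exists U, full_Gset r s U /\
  boundary mul r s (fun g => indic U g - F g).
Proof.
have Com := offdiag_Cc; have om0 := offdiag_ge0.
have mE : push setT r offdiag = msize := offdiag_cycle.
have fins : fiber_finite setT s offdiag by exact: Cc_fiber_finite.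
have finr : fiber_finite setT r offdiag by exact: Cc_fiber_finite.
(* One label separates the fibres of both [r] and [s], so the same arrows can be ranked by source
   and by range. *)
have [|n [la2 [lla2 _ sepla2]]] := @compact_label G [set g | offdiag g != 0]
    (fun A => {in A &, injective r} /\ {in A &, injective s}) (Cc_compact Com).
  move=> g _; have [_ _ /(_ g)[V [oV Vg rV]]] := er.
  have [_ _ /(_ g)[V' [oV' V'g sV]]] := es.
  have [B [cB Bg BV]] := bG (openI oV oV') (conj Vg V'g).
  exists B; split=> //; split=> x y; rewrite !inE => /BV[Vx Vx'] /BV[Vy Vy'].
    by apply: rV; rewrite inE.
  by apply: sV; rewrite inE.
have injs y x x' : s x = y -> s x' = y -> offdiag x != 0 -> offdiag x' != 0 ->
    la2 x = la2 x' -> x = x'.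
  move=> sx sx' ox ox' /(sepla2 _ _ ox ox')[A [[_ iA] Ax Ax']].
  by apply: iA; rewrite ?inE// sx.
have injr y x x' : r x = y -> r x' = y -> offdiag x != 0 -> offdiag x' != 0 ->
    la2 x = la2 x' -> x = x'.
  move=> rx rx' ox ox' /(sepla2 _ _ ox ox')[A [[iA _] Ax Ax']].
  by apply: iA; rewrite ?inE// rx.
pose a g := cum s offdiag la2 (la2 g) (s g).
pose b g := cum r offdiag la2 (la2 g) (r g).
have bound g : offdiag g != 0 -> [/\ 0 <= a g, a g + offdiag g <= msize (s g),
    0 <= b g & b g + offdiag g <= msize (r g)].
  move=> og; split; [exact: cum_ge0| |exact: cum_ge0|rewrite -mE].
    by apply: rank_bound => //; exact: injs.
  by apply: rank_bound => //; exact: injr.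
have sursE y (q : int) : unit_space r y -> height y = 0 -> 0 <= q < msize y ->
    exists g, s g = y /\ a g <= q < a g + offdiag g.
  move=> _ _ qm; have [g [sg gq]] := rank_exists fins (injs y) qm.
  by exists g; rewrite /a sg.
have surrE y (q : int) : unit_space r y -> height y = 0 -> 0 <= q < msize y ->
    exists g, r g = y /\ b g <= q < b g + offdiag g.
  rewrite -mE => _ _ qm; have [g [rg gq]] := rank_exists finr (injr y) qm.
  by exists g; rewrite /b rg.
have injsE g g' (q : int) : s g = s g' -> a g <= q < a g + offdiag g ->
     a g' <= q < a g' + offdiag g' -> g = g'.
  rewrite /a => e; rewrite e => gq gq'.
  exact: (rank_unique fins om0 (injs (s g')) e erefl gq gq').
have injrE g g' (q : int) : r g = r g' -> b g <= q < b g + offdiag g ->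
     b g' <= q < b g' + offdiag g' -> g = g'.
  rewrite /b => e; rewrite e => gq gq'.
  exact: (rank_unique finr om0 (injr (r g')) e erefl gq gq').
pose U := pack offdiag a b msize.
(* This is the inverse of [U]: its properties with respect to [s] are those of [U] with respect to
   [r]. *)
pose U' := pack (offdiag \o inv) (b \o inv) (a \o inv) msize.
have base' g : (offdiag \o inv) g != 0 -> height (r g) = 0 /\ height (s g) = 0.
  by move=> /offdiag_base; rewrite (g_rV gG) (g_sV gG) => -[].
have bound' g : (offdiag \o inv) g != 0 ->
    [/\ 0 <= (b \o inv) g, (b \o inv) g + (offdiag \o inv) g <= msize (s g),
    0 <= (a \o inv) g & (a \o inv) g + (offdiag \o inv) g <= msize (r g)].
  by move=> /bound /=; rewrite (g_rV gG) (g_sV gG) => -[].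
have sU : s @` U = unit_space r by exact: (pack_surj offdiag_base bound m_size sursE).
have isU : {in U &, injective s} by exact: (pack_inj bound injsE).
have sU' : s @` U' = unit_space r.
  apply: (pack_surj base' bound' m_size) => y q uy hy qm.
  have [g [rg gq]] := surrE y q uy hy qm.
  by exists (inv g); rewrite (g_sV gG) /= (g_invK gG).
have isU' : {in U' &, injective s}.
  apply: (pack_inj bound') => g g' q sgg gq gq'; apply: (can_inj (g_invK gG)).
  by apply: injrE gq gq'; rewrite !(g_rV gG).
have UU' w : U (inv w) <-> U' w := pack_inv offdiag a b msize w.
have rU : r @` U = unit_space r.
  apply/seteqP; split=> [_ [w _ <-]|x]; first exact: unit_r.
  by rewrite -sU' => -[w /UU' Uw <-]; exists (inv w) => //; rewrite (g_rV gG).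
have irU : {in U &, injective r}.
  move=> w w'; rewrite !inE => Uw Uw' rww; apply: (can_inj (g_invK gG)).
  by apply: isU'; rewrite ?inE ?(g_sV gG)//; apply/UU'; rewrite (g_invK gG).
have cum_lc (f : G -> G) : etale f -> forall i, loc_const (cum f offdiag la2 i).
  move=> ef i; apply: Cc_loc_const; apply: Cc_push => //; apply: (Cc_supp _ Com).
    exact: (@loc_const_fun2 G _ _ _ la2 offdiag (fun j v => if (j < i)%N then v else 0)
             lla2 (Cc_loc_const Com)).
  by move=> x ->; rewrite if_same.
have opU : open U.
  apply: pack_open => //; [exact: Cc_loc_const|exact/Cc_loc_const/Cc_push|].
  move=> g _; have n1 := lla2 g.
  have n2 : nbhs g (s @^-1` [set x | cum s offdiag la2 (la2 g) x = a g]).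
    by apply: cs; exact: cum_lc.
  have n3 : nbhs g (r @^-1` [set x | cum r offdiag la2 (la2 g) x = b g]).
    by apply: cr; exact: cum_lc.
  apply: filterS (filterI n1 (filterI n2 n3)) => h [e1 [e2 e3]].
  by rewrite /a /b e1; split.
have cmU : compact U by apply: (etale_compact_preimage es opU isU); rewrite sU.
have CU : Cc_on setT (indic U) by exact: Cc_indic.
exists U; split; first by split.
have pushU (f : G -> G) : f @` U = unit_space r -> {in U &, injective f} ->
    push setT f (indic U) = indic (unit_space r).
  move=> fU ifU; apply/funext => y; rewrite {2}/indic; case: asboolP => uy.
    move: uy; rewrite -fU => -[u Uu <-]; rewrite push_eq1//.
      by rewrite /indic asboolT.
    move=> u' _ fu'; rewrite /indic; case: asboolP => // Uu' _.
    by apply: ifU; rewrite ?inE.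
  apply: push_eq0 => u _ fu; rewrite /indic; case: asboolP => // Uu.
  by exfalso; apply: uy; rewrite -fU; exists u.
pose chi g := indic U g - F g.
have Cchi : Cc_on setT chi by apply: CcD => //; exact: CcN.
have pushB (f : G -> G) : etale f -> push setT f chi =
    fun y => push setT f (indic U) y - push setT f F y.
  move=> ef; apply/funext => y; rewrite -pushN -pushD//; apply: Cc_fiber_finite => //.
  exact: CcN.
(* Both pushforwards of the indicator of [U] are the indicator of the units. *)
have cycchi : push setT r chi = push setT s chi.
  by rewrite !pushB// !pushU// cycF.
have := boundary_cycle Cchi cycchi.
have -> : push setT rho (push setT rho' chi) = push setT pi chi.
  apply/funext => y; apply: push_comp; apply: Cc_fiber_finite => //; exact: pi_etale.
(* By [pack_count] this pushforward vanishes off the units. *)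
have Bpi : boundary mul r s (push setT pi chi).
  apply: (boundary_unit gG hG er cU oU) => [|g ug].
    by apply: Cc_push => //; exact: pi_etale.
  rewrite pushB; last exact: pi_etale.
  rewrite (pack_count offdiag_base bound m_size)//.
  by rewrite /offdiag asboolF// subrr.
move=> B; have := boundaryD gG er es B Bpi.
congr boundary; apply/funext => g; exact: subrK.
Qed.

End Cycle.

(** * Weight estimates against orbit sizes *)

Lemma orbit_size_ge y : unit_space r y ->
  [/\ (0 < #|` fset_set (Korb r s K y)|)%N &
      (#|` fset_set (Korb r s K y)|)%:Z <= orbit_size y].
Proof.
move=> uy; have finK : finite_set (Kx s K y).
  by apply: sub_finite_set (@etale_finite G G s K y es elem_compact) => k [].
have finO : finite_set (Korb r s K y) by exact: finite_image.
split.
  rewrite cardfs_gt0; apply/fset0Pn; exists (r y); rewrite in_fset_set// inE.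
  by exists y => //; split; [exact: elem_unit | exact: (unit_sE gG)].
rewrite /orbit_size (push_seq (l := fset_set (Kx s K y)))//; last first.
  by move=> x _ sx /iKN Kx; rewrite in_fset_set// inE.
have -> : \sum_(x <- fset_set (Kx s K y) | s x == y) iK x =
    \sum_(x <- fset_set (Kx s K y)) (1 : int).
  rewrite big_seq_cond [RHS]big_seq; apply: congr_big => // x.
    case: (boolP (x \in _)) => //=; rewrite in_fset_set// inE => -[_ ->].
    by rewrite eqxx.
  by move=> /andP[]; rewrite in_fset_set// inE => -[/iK1 ->].
rewrite big_const_seq count_predT iter_addr_0 natz lez_nat.
rewrite /Korb fset_set_image//; exact: leq_imfset_card.
Qed.

Lemma CKx_finite C y : compact C -> finite_set (CKx mul r s C K y).
Proof.
move=> cC; have finK : finite_set (Kx s K y).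
  by apply: sub_finite_set (@etale_finite G G s K y es elem_compact) => k [].
have : finite_set (\bigcup_(k in Kx s K y) ((mul^~ k) @` (C `&` s @^-1` [set r k]))).
  by apply: bigcup_finite => // k _; apply: finite_image; exact: etale_finite.
by apply: sub_finite_set => g [c [k [Cc Kk ck ->]]]; exists k => //; exists c.
Qed.

(** Moving ranges by [rho] preserves sources, so the weight can be counted on the arrows obtained by
    [rho'] alone. Those that count lie in the set measured by almost finiteness, and each weighs at
    most [n]. *)
Lemma offdiag_size F (n : nat) y : Cc_on setT F -> (forall g, 0 <= F g) ->
  (forall x, push setT r F x <= n%:Z) -> unit_space r y -> height y = 0 ->
  push setT s (offdiag F) y <=
  (n * #|` fset_set (CKx mul r s [set g | F g != 0%R] K y `\` Kx s K y)|)%:Z.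
Proof.
move=> CF F0 Fn uy hy.
set A := fset_set _.
have finA : finite_set (CKx mul r s [set g | F g != 0%R] K y `\` Kx s K y).
  by apply: finite_setD; apply: CKx_finite; exact: Cc_compact.
pose F' := push setT rho' F.
have CF' : Cc_on setT F' by apply: Cc_push => //; exact: rho'_etale.
pose F'' z := if `[< unit_space r (rho z) >] then 0 else F' z.
have CF'' : Cc_on setT F''.
  apply: (Cc_supp _ CF'); last by move=> x p0; rewrite /F'' p0 if_same.
  apply: (@loc_const_fun2 G _ _ _ _ _ (fun (b : bool) v => if b then 0 else v)).
    apply: (@loc_const_comp G G _ rho (fun x => `[< unit_space r x >])).
      by case: rho_etale.
    by apply: clopen_loc_const; split=> //; exact: compact_closed.
  exact: Cc_loc_const.
have offE : offdiag F = push setT rho F''.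
  apply/funext => g; rewrite /offdiag; case: asboolP => ug.
    apply/esym/push_eq0 => z _ rz; rewrite /F'' rz; by case: asboolP.
  rewrite -(@push_comp _ _ _ rho' rho); last first.
    by apply: Cc_fiber_finite => //; exact: pi_etale.
  apply: eq_fsbigr => z; rewrite inE => -[_ /= rz].
  by rewrite /F'' rz asboolF.
have -> : push setT s (offdiag F) y = push setT s F'' y.
  have e : s \o rho = s by apply/funext => g; exact: s_rho.
  by rewrite offE push_comp e//; exact: Cc_fiber_finite.
have F'n z : F'' z <= n%:Z.
  have F'0 x : 0 <= F' x by exact: push_ge0.
  rewrite /F''; case: ifP => // _; apply: le_trans (Fn (r z)).
  have -> : push setT r F (r z) = push setT r F' (r z).
    have e : r \o rho' = r by apply/funext => g; exact: r_rho'.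
    by rewrite /F' push_comp e//; exact: Cc_fiber_finite.
  exact: (term_le_push (Cc_fiber_finite er CF')).
rewrite (push_seq (l := A))//; last first.
  move=> z _ sz; rewrite /F''; case: asboolP => // nu /push_neq0[e [_ re Fe]].
  rewrite /A in_fset_set// inE; split.
    exists e, (inv (t (s e))); split; [by [] | | exact: comp_rho' | exact: (esym re)].
    split; first by apply: elem_inv; exact/t_K/(unit_s gG).
    by rewrite (g_sV gG) -s_rho' re.
  (* An element of [K] with source the lowest point [y] is sent by [rho] to [t y], which is the unit
     [y]. *)
  move=> [Kz _]; apply: nu; by rewrite /rho -t_shift// sz t_top.
apply: (@le_trans _ _ (\sum_(x <- A) n%:Z)).
  by rewrite big_mkcond; apply: ler_sum => x _; case: ifP.
by rewrite big_const_seq count_predT iter_addr_0 -mulr_natr natz -PoszM.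
Qed.
End Elementary.

Theorem theorem7p5 (G : topologicalType)
    (mul : G -> G -> G) (inv : G -> G) (r s : G -> G) :
  is_etale_groupoid mul inv r s ->
  @second_countable G ->
  essentially_principal r s ->
  compact (unit_space r) ->
  totally_disconnected (unit_space r) ->
  almost_finite mul inv r s ->
  index_map_surjective mul r s.
Proof.
move=> [gG [hG _ cM cV lhr]] _ ep cU tdU af f Cf cycf.
have oU : open (unit_space r) by rewrite -ep; exact: open_interior.
have er : etale r by exact: local_homeo_etale lhr.
have es : etale s.
  have -> : s = r \o inv by apply/funext => g /=; rewrite (g_rV gG).
  by apply: etale_comp_involution => //; exact: (g_invK gG).
have bG : clopen_basis G by apply: (etale_clopen_basis (E := unit_space r) hG er).
have lf := Cc_loc_const Cf.
pose fp g : int := Num.max (f g) 0; pose fn g : int := Num.max (- f g) 0.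
have fE g : f g = fp g - fn g.
  by rewrite /fp /fn; case: (ltP (f g) 0) => h; [rewrite max_l|rewrite max_r]; lia.
have Cfp : Cc_on setT fp.
  apply: (Cc_supp _ Cf); first exact: (loc_const_fun (fun v => Num.max v 0) lf).
  by move=> x fx; rewrite /fp fx maxxx.
have Cfn : Cc_on setT fn.
  apply: (Cc_supp _ Cf); first exact: (loc_const_fun (fun v => Num.max (- v) 0) lf).
  by move=> x fx; rewrite /fn fx oppr0 maxxx.
have einv : etale inv.
  have eid : etale (id : G -> G).
    split=> [x|O oO|x]; [exact: cvg_id | by rewrite image_id |].
    by exists setT; split=> //; exact: openT.
  exact: (etale_comp_involution cV (g_invK gG) eid).
have fnVE : fn \o inv = push setT inv fn.
  apply/funext => g /=; have := @push_eq1 G G setT inv fn (inv g) I.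
  by rewrite (g_invK gG) => -> // x _ /(congr1 inv); rewrite (g_invK gG).
have CfnV : Cc_on setT (fn \o inv) by rewrite fnVE; exact: Cc_push.
pose F g : int := fp g + (fn \o inv) g.
have CF : Cc_on setT F by exact: CcD.
have F0 g : 0 <= F g.
  by rewrite /F /fp /fn /=; apply: addr_ge0; rewrite le_max lexx orbT.
have pushF (h h' : G -> G) : etale h -> etale h' -> h \o inv = h' ->
    forall y, push setT h F y = push setT h fp y + push setT h' fn y.
  move=> eh eh' hh y; rewrite pushD; try exact: Cc_fiber_finite.
  by congr (_ + _); rewrite fnVE push_comp hh//; exact: Cc_fiber_finite.
have rV : r \o inv = s by apply/funext => g; exact: (g_rV gG).
have sV : s \o inv = r by apply/funext => g; exact: (g_sV gG).
(* Inversion exchanges [r] and [s] on the negative part, so the difference of the two pushforwards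
   of [F] is that of [f]. *)
have cycF : push setT r F = push setT s F.
  apply/funext => y; rewrite (pushF r s)// (pushF s r)//.
  (* The cycle condition on [f] speaks of units only; elsewhere both pushforwards are 0. *)
  have [uy|uy] := pselect (unit_space r y); last first.
    have p0 phi (h : G -> G) : (forall g, unit_space r (h g)) -> push setT h phi y = 0.
      by move=> hU; apply: push_eq0 => x _ hx; exfalso; apply: uy; rewrite -hx.
    by rewrite !p0//; (try exact: unit_r); exact: (unit_s gG).
  have := cycf y uy; rewrite /delta1.
  have pushf (h : G -> G) : etale h -> push setT h f y = push setT h fp y - push setT h fn y.
    move=> eh; rewrite -pushN -pushD; [|exact: Cc_fiber_finite|].
      by congr (push _ _ _ _); apply/funext => g; exact: fE.
    by apply: Cc_fiber_finite => //; exact: CcN.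
  by rewrite !pushf//; lia.
have [n Hn] := Cc_bounded (Cc_push hG bG er CF).
(* With weights at most [n] per arrow, a ratio below [1/(n+1)] keeps the total weight under the
   orbit size; the successor keeps the constant positive when [n] is 0. *)
have [|K [eK HK]] := af [set g | F g != 0] (n.+1%:R^-1) (Cc_compact CF).
  by rewrite invr_gt0 ltr0n.
have [la [lla laK]] := elem_label_exists gG hG bG er es cU oU eK.
have [t Ht] := base_section_exists gG hG es eK laK.
have [|U [fU BU]] := cycle_full_Gset gG hG bG er es cM cV cU oU eK lla laK Ht CF F0 cycF.
  move=> y uy hy.
  have := offdiag_size gG hG bG er es cM cV cU oU eK lla laK Ht CF F0 Hn uy hy.
  move/le_trans; apply.
  have [c0 cN] := orbit_size_ge gG es eK uy.
  apply: le_trans cN; rewrite lez_nat; have := HK y uy.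
  rewrite ltr_pdivrMr ?ltr0n// ltr_pdivlMl ?ltr0n// -natrM ltr_nat.
  lia.
exists U; split=> //.
(* The cycle [F] differs from [f] by [fn] plus its composite with [inv], a boundary. *)
have := boundaryD gG er es BU (boundary_inv gG hG bG er es cM cV cU oU Cfn).
suff -> : (fun g => indic U g - F g + (fn g + fn (inv g))) = (fun g => indic U g - f g) by [].
apply/funext => g; rewrite /F fE /=; lia.
Qed.
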